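(* Let $\mathcal{H}$ be a Hilbert space, let $A,B\in\mathcal{B}(\mathcal{H})$ be two positive invertible operators, and let $m,M$ be real numbers such that $0<m\mathbf{1}_{\mathcal{H}}\le \mathbf{1}_{\mathcal{H}}\le A^{-\frac12}BA^{-\frac12}\le M\mathbf{1}_{\mathcal{H}}$. Let $\Phi$ be a unital positive linear map on $\mathcal{B}(\mathcal{H})$. (1) If $0\le p\le 1$, then $$\Phi(A)\sharp_p\Phi(B)\le \Phi(A\sharp_p B)+p\left(m^{p-1}-M^{p-1}\right)\Phi(B-A).$$ (2) If $-1\le p\le 0$, then $$\Phi(A)\natural_p\Phi(B)\ge \Phi(A\natural_p B)+p\left(m^{p-1}-M^{p-1}\right)\Phi(B-A).$$ (3) If $1\le p\le 2$, then $$\Phi(A\natural_p B)\le \Phi(A)\natural_p\Phi(B)+p\left(M^{p-1}-m^{p-1}\right)\Phi(B-A).$$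
   Context: $\mathcal{B}(\mathcal{H})$ is the $C^*$-algebra of all bounded linear operators on the Hilbert space $\mathcal{H}$, and $\mathbf{1}_{\mathcal{H}}$ is the identity operator. $X\le Y$ means that $X$ and $Y$ are self-adjoint and $Y-X$ is positive (positive means positive semidefinite); $0<X$ means that $X$ is positive and invertible. A linear map $\Phi:\mathcal{B}(\mathcal{H})\to\mathcal{B}(\mathcal{H})$ is positive if it maps positive operators to positive operators, and unital if $\Phi(\mathbf{1}_{\mathcal{H}})=\mathbf{1}_{\mathcal{H}}$. For invertible positive operators $A,B$ and $p\in\mathbb{R}$, set $A\natural_p B=A^{\frac12}\left(A^{-\frac12}BA^{-\frac12}\right)^pA^{\frac12}$; when $0\le p\le 1$ this is written $A\sharp_p B$. *)

(* Defs.v *)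
From HB Require Import structures.
From mathcomp Require Import all_boot all_order all_algebra.
From mathcomp Require Import all_classical all_reals all_analysis.
From mathcomp.real_closed Require Import complex.

Set Implicit Arguments.
Unset Strict Implicit.
Unset Printing Implicit Defensive.

Import Order.TTheory GRing.Theory Num.Theory.
Import numFieldTopology.Exports numFieldNormedType.Exports.

Local Open Scope classical_set_scope.
Local Open Scope ring_scope.
Local Open Scope complex_scope.

(* The inner product is linear in its first argument and conjugate-linear in
   the second. No hypothesis excludes the zero space, so the operators below
   form a possibly trivial ring ([pzRingType]). *)
HB.mixin Record CompleteNormedModule_isHilbert (R : realType) H
    of CompleteNormedModule R[i] H := {
  inner : {dot H for @conjc R} ;
  inner_norm : forall x : H, inner x x = `|x| ^+ 2
}.

#[short(type="hilbertType")]
HB.structure Definition Hilbert (R : realType) :=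
  { H of CompleteNormedModule R[i] H & CompleteNormedModule_isHilbert R H }.

Section BoundedOperators.
Variables (R : realType) (H : hilbertType R).

Definition is_bop : {pred H -> H} := fun f =>
  `[< linear f /\ exists C : R, forall x, `|f x| <= C%:C * `|x| >].

Record bop := Bop { bop_fun :> H -> H ; _ : bop_fun \in is_bop }.

HB.instance Definition _ := [isSub for bop_fun].
HB.instance Definition _ := [Choice of bop by <:].

Lemma is_bopP (f : H -> H) : reflect
  (linear f /\ exists C : R, forall x, `|f x| <= C%:C * `|x|) (f \in is_bop).
Proof. exact: asboolP. Qed.

Lemma is_bop_submod : submod_closed is_bop.
Proof.
split=> [|a f g /is_bopP[lf [C hC]] /is_bopP[lg [D hD]]].
  apply/is_bopP; split=> [b x y|]; first by rewrite scaler0 addr0.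
  by exists 0 => x; rewrite mul0r normr0.
apply/is_bopP; split=> [b x y|].
  rewrite /= !fctE lf lg !scalerDr !scalerA (mulrC a b) -!addrA.
  by congr (_ + _); rewrite addrCA.
exists (Normc.normc a * C + D) => x; rewrite rmorphD rmorphM /=.
apply: le_trans (ler_normD _ _) _; rewrite mulrDl -mulrA normrZ lerD//.
exact: ler_wpM2l.
Qed.

HB.instance Definition _ := GRing.isSubmodClosed.Build R[i] (H -> H) is_bop
  is_bop_submod.
HB.instance Definition _ := [SubChoice_isSubLmodule of bop by <:].

Lemma is_bop_id : id \in is_bop.
Proof. by apply/is_bopP; split=> //; exists 1 => x; rewrite mul1r. Qed.

Lemma is_bop_comp (X Y : bop) : X \o Y \in is_bop.
Proof.
case: X Y => [f /= /is_bopP[lf [C hC]]] [g /= /is_bopP[lg [D hD]]].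
apply/is_bopP; split=> [a x y|]; first by rewrite /= lg lf.
exists (`|C| * D) => x /=; rewrite rmorphM /= -mulrA.
apply: le_trans (hC _) _; apply: (@le_trans _ _ (`|C|%:C * `|g x|)).
  by rewrite ler_wpM2r// lecR ler_norm.
by rewrite ler_wpM2l// lecR.
Qed.

Definition bop1 : bop := Bop is_bop_id.
Definition bop_mul (X Y : bop) : bop := Bop (is_bop_comp X Y).

Lemma bopP (X Y : bop) : X =1 Y -> X = Y.
Proof. by move=> XY; apply/val_inj/funext. Qed.

Fact bop_mulA : associative bop_mul.
Proof. by move=> X Y Z; apply: bopP. Qed.
Fact bop_mul1r : left_id bop1 bop_mul.
Proof. by move=> X; apply: bopP. Qed.
Fact bop_mulr1 : right_id bop1 bop_mul.
Proof. by move=> X; apply: bopP. Qed.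
Fact bop_mulrDl : left_distributive bop_mul +%R.
Proof. by move=> X Y Z; apply: bopP. Qed.
Fact bop_mulrDr : right_distributive bop_mul +%R.
Proof.
move=> [f fP] [g gP] [h hP]; apply: bopP => x /=.
have /is_bopP[lf _] := fP.
by have := lf 1 (g x) (h x); rewrite !scale1r.
Qed.

HB.instance Definition _ := GRing.Zmodule_isPzRing.Build bop
  bop_mulA bop_mul1r bop_mulr1 bop_mulrDl bop_mulrDr.

End BoundedOperators.

Notation "''B(' H )" := (bop H) (format "''B(' H )") : type_scope.

Section OperatorCalculus.
Variables (R : realType) (H : hilbertType R).
Implicit Types (X Y A B : 'B(H)) (f : R -> R).

Definition selfadjoint X := forall x y : H, inner (X x) y = inner x (X y).

(* The order on [R[i]] makes [0 <= z] say that [z] is real and nonnegative. *)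
Definition positive X := forall x : H, 0 <= inner (X x) x.

Definition invertible X := exists Y, X * Y = 1 /\ Y * X = 1.

Definition op_le X Y := [/\ selfadjoint X, selfadjoint Y & positive (Y - X)].

Definition op_gt0 X := positive X /\ invertible X.

Definition opnorm X : R := sup [set complex.Re `|X x| | x in [set x | `|x| <= 1]].

Definition spectrum X : set R[i] := [set z : R[i] | ~ invertible (X - z *: (1 : 'B(H)))].

Definition op_horner (P : {poly R}) X : 'B(H) :=
  \sum_(i < size P) (P`_i)%:C *: X ^+ i.

(* [Y] is the value at [X] of the continuous functional calculus for [f]:
   the norm limit of [P n] evaluated at [X], for polynomials [P n] converging
   to [f] uniformly on the spectrum. Only real points are involved because
   this is meant for self-adjoint [X], whose spectrum is real. *)
Definition is_fcalc f X Y := exists P : nat -> {poly R},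
  {uniform [set t : R | spectrum X t%:C], (fun n => horner (P n)) @ \oo --> f}
  /\ opnorm (op_horner (P n) X - Y) @[n --> \oo] --> (0 : R).

Definition fcalc f X : 'B(H) := xget 0 (is_fcalc f X).

Definition op_powR X (p : R) : 'B(H) := fcalc (fun t => t `^ p) X.

(* $A \natural_p B$, which is also $A \sharp_p B$ when $0 \le p \le 1$. *)
Definition op_mean (p : R) A B : 'B(H) :=
  let A_half := op_powR A 2^-1 in
  let A_mhalf := op_powR A (- 2^-1) in
  A_half * op_powR (A_mhalf * B * A_mhalf) p * A_half.

Definition positive_map (Phi : 'B(H) -> 'B(H)) :=
  forall X, positive X -> positive (Phi X).

End OperatorCalculus.

Notation "X ⪯ Y" := (op_le X Y) (at level 70, no associativity) : ring_scope.
Notation "A ♮_ p B" := (op_mean p A B)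
  (at level 40, p at level 2, no associativity, format "A  ♮_ p  B") : ring_scope.

(* Main.v *)
Require Import Defs.
From HB Require Import structures.
From mathcomp Require Import all_boot all_order all_algebra.
From mathcomp Require Import all_classical all_reals all_analysis.
From mathcomp.real_closed Require Import complex.
From mathcomp Require Import ring lra.

Set Implicit Arguments.
Unset Strict Implicit.
Unset Printing Implicit Defensive.

Import Order.TTheory GRing.Theory Num.Theory.
Import numFieldTopology.Exports numFieldNormedType.Exports.
Local Open Scope classical_set_scope.
Local Open Scope ring_scope.
Local Open Scope complex_scope.

(** The idea is to compare [t ^ p] with the lines through [(1, 1)]. For [t >= 1]
    the mean value theorem gives [t ^ p = 1 + p c ^ (p - 1) (t - 1)] for some
    [c] between [1] and [t] ([powR_slope]). If [t <= M] and [m <= 1], then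
    [c ^ (p - 1)] lies between [m ^ (p - 1)] and [M ^ (p - 1)], so that [t ^ p]
    lies between two lines whose slopes are [p] times these two numbers.

    Apply this to [X = A ^ (-1/2) B A ^ (-1/2)], whose spectrum lies in
    [[1, M]], and conjugate by [A ^ (1/2)]: the mean of [A] and [B] compares with
    [A + s (B - A)], where [s] is one of the two slopes ([op_mean_le],
    [op_mean_ge]). The positive unital map [Phi] keeps this comparison, and it
    keeps [A <= B], so that the normalized operator of the pair [Phi A], [Phi B]
    is also at least [1]; the bound with the slope at [m], which holds for all
    [t >= 1], applies to it. The two comparisons share the term [Phi A], and
    their difference is the difference of the two slopes times [Phi (B - A)].

    What this argument asks of the functional calculus is monotonicity,
    multiplicativity and existence for power functions. All three rest on one
    fact: if a real polynomial [P] is nonnegative on the real spectrum of a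
    self-adjoint [X], then [P(X)] is positive ([op_horner_ge0]). Let [l] be
    the greatest lower bound of the quadratic form of [P(X)]. Were [l] negative,
    [P - l] would have no zero in the spectrum; the factorization of [P - l] over
    the complex numbers would make [P(X) - l] invertible, and a positive
    invertible operator is bounded below by a positive constant
    ([invertible_coercive]), which contradicts the choice of [l]. Invertibility
    comes from the Neumann series: a self-adjoint operator that is bounded below
    by a positive constant is invertible ([coercive_invertible]). Existence
    needs uniform polynomial approximation of power functions on intervals
    [[u, v]] with [0 < u]; these functions are Lipschitz there, and Bernstein
    polynomials approximate them. *)

(** * The real Hilbert space structure and bounded operators *)

Section RealHilbert.
Variables (R : realType) (H : hilbertType R).
Implicit Types (x y z : H) (a : R) (X Y Z T S : 'B(H)).

(** The norm and the inner product take values in [R[i]]; norms are real, and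
    quadratic forms of self-adjoint operators are too, so all estimates are
    carried out in [R] with the real parts. *)
Definition rnorm x : R := complex.Re `|x|.
Definition rinner x y : R := complex.Re (inner x y).

Lemma rnormE x : `|x| = (rnorm x)%:C.
Proof. by rewrite /rnorm RRe_real// ger0_real. Qed.

Lemma rnorm_ge0 x : 0 <= rnorm x.
Proof. by rewrite -ler0c -rnormE. Qed.

Lemma rnorm_eq0 x : (rnorm x == 0) = (x == 0).
Proof. by rewrite -(inj_eq (@complexI R)) -rnormE normr_eq0. Qed.

Lemma rnormD x y : rnorm (x + y) <= rnorm x + rnorm y.
Proof. by rewrite -lecR rmorphD /= -!rnormE ler_normD. Qed.

Lemma rnormN x : rnorm (- x) = rnorm x.
Proof. by rewrite /rnorm normrN. Qed.

Lemma rnormB x y : rnorm (x - y) <= rnorm x + rnorm y.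
Proof. by rewrite -(rnormN y) rnormD. Qed.

Lemma rnorm_distrC x y : rnorm (x - y) = rnorm (y - x).
Proof. by rewrite -rnormN opprB. Qed.

Lemma rnormZ a x : rnorm (a%:C *: x) = `|a| * rnorm x.
Proof.
apply: (@complexI R); rewrite -rnormE normrZ rnormE rmorphM /=; congr (_ * _).
by rewrite normc_def /= expr0n addr0 sqrtr_sqr.
Qed.

Lemma innerDl x y z : inner (x + y) z = inner x z + inner y z.
Proof. exact: linearDl. Qed.

Lemma innerDr x y z : inner z (x + y) = inner z x + inner z y.
Proof. exact: linearDr. Qed.

Lemma innerNl x z : inner (- x) z = - inner x z.
Proof. exact: linearNl. Qed.

Lemma innerNr x z : inner z (- x) = - inner z x.
Proof. exact: linearNr. Qed.

Lemma innerZl (c : R[i]) x z : inner (c *: x) z = c * inner x z.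
Proof. exact: linearZl_LR. Qed.

Lemma innerZr (c : R[i]) x z : inner z (c *: x) = conjc c * inner z x.
Proof. exact: linearZr_LR. Qed.

Lemma innerC x y : inner x y = conjc (inner y x).
Proof. by rewrite hermC expr0 mul1r. Qed.

Lemma rinnerC x y : rinner x y = rinner y x.
Proof. by rewrite /rinner innerC; case: (inner y x). Qed.

Lemma rinnerDl x y z : rinner (x + y) z = rinner x z + rinner y z.
Proof. by rewrite /rinner innerDl raddfD. Qed.

Lemma rinnerNl x z : rinner (- x) z = - rinner x z.
Proof. by rewrite /rinner innerNl raddfN. Qed.

Lemma rinnerBl x y z : rinner (x - y) z = rinner x z - rinner y z.
Proof. by rewrite rinnerDl rinnerNl. Qed.

Lemma Re_mulC a (w : R[i]) : complex.Re (a%:C * w) = a * complex.Re w.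
Proof. by case: w => b c /=; rewrite mul0r subr0. Qed.

Lemma rinnerZl a x z : rinner (a%:C *: x) z = a * rinner x z.
Proof. by rewrite /rinner innerZl Re_mulC. Qed.

Lemma rinnerDr x y z : rinner z (x + y) = rinner z x + rinner z y.
Proof. by rewrite rinnerC rinnerDl !(rinnerC z). Qed.

Lemma rinnerNr x z : rinner z (- x) = - rinner z x.
Proof. by rewrite rinnerC rinnerNl rinnerC. Qed.

Lemma rinnerBr x y z : rinner z (x - y) = rinner z x - rinner z y.
Proof. by rewrite rinnerDr rinnerNr. Qed.

Lemma rinnerZr a x z : rinner z (a%:C *: x) = a * rinner z x.
Proof. by rewrite rinnerC rinnerZl rinnerC. Qed.

Lemma rinnerxx x : rinner x x = rnorm x ^+ 2.
Proof. by rewrite /rinner inner_norm rnormE -rmorphXn. Qed.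

Lemma rnorm_le_sqr x a : 0 <= a -> rnorm x ^+ 2 <= a ^+ 2 -> rnorm x <= a.
Proof. by move=> a0; rewrite ler_sqr// nnegrE rnorm_ge0. Qed.

(** This form of the Cauchy-Schwarz inequality is what operator bounds provide;
    it follows from the nonnegativity of the norms of [x + e y] and [x - e y]. *)
Lemma normr_rinner_le (e : R) x y : 0 <= e -> rnorm x <= e * rnorm y ->
  `|rinner x y| <= e * rnorm y ^+ 2.
Proof.
rewrite le_eqVlt => /predU1P[<-|e0].
  rewrite mul0r => x0; have /eqP -> : x == 0 by rewrite -rnorm_eq0 eq_le x0 rnorm_ge0.
  by rewrite /rinner linear0l normr0 mul0r.
move=> xy; have xy2 : rnorm x ^+ 2 <= e ^+ 2 * rnorm y ^+ 2.
  by rewrite -exprMn ler_sqr// nnegrE ?rnorm_ge0// mulr_ge0 ?rnorm_ge0// ltW.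
have H1 : 0 <= rinner (x + e%:C *: y) (x + e%:C *: y).
  by rewrite rinnerxx exprn_ge0// rnorm_ge0.
have H2 : 0 <= rinner (x - e%:C *: y) (x - e%:C *: y).
  by rewrite rinnerxx exprn_ge0// rnorm_ge0.
move: H1 H2; rewrite !rinnerDl !rinnerDr !rinnerNl !rinnerNr !rinnerZl !rinnerZr.
rewrite !rinnerxx (rinnerC y x).
move=> H1 H2; rewrite ler_norml; apply/andP.
split; rewrite -(ler_pM2l e0); nra.
Qed.

Lemma bopDE X Y x : (X + Y) x = X x + Y x. Proof. by []. Qed.
Lemma bopNE X x : (- X) x = - X x. Proof. by []. Qed.
Lemma bopBE X Y x : (X - Y) x = X x - Y x. Proof. by []. Qed.
Lemma bopZE (c : R[i]) X x : (c *: X) x = c *: X x. Proof. by []. Qed.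
Lemma bopME X Y x : (X * Y) x = X (Y x). Proof. by []. Qed.
Lemma bop1E x : (1 : 'B(H)) x = x. Proof. by []. Qed.
Lemma bop0E x : (0 : 'B(H)) x = 0. Proof. by []. Qed.

Definition bopE := (bopDE, bopNE, bopZE, bopME, bop1E, bop0E).

(** Estimates are phrased through bounds instead of [opnorm], because a bound
    can be checked vector by vector. *)
Definition opbound T (c : R) := forall x, rnorm (T x) <= c * rnorm x.

Lemma opD T x y : T (x + y) = T x + T y.
Proof. by case: T => f /= /is_bopP[lf _]; have := lf 1 x y; rewrite !scale1r. Qed.

Lemma op0 T : T 0 = 0.
Proof. by apply: (addIr (T 0)); rewrite -opD !add0r. Qed.

Lemma opZ T (c : R[i]) x : T (c *: x) = c *: T x.
Proof.
by case: T (op0 T) => f /= /is_bopP[lf _] f0; rewrite -[c *: x]addr0 lf f0 addr0.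
Qed.

Lemma opN T x : T (- x) = - T x.
Proof. by rewrite -scaleN1r opZ scaleN1r. Qed.

Lemma opB T x y : T (x - y) = T x - T y.
Proof. by rewrite opD opN. Qed.

Lemma bop_scalerAl (c : R[i]) X Y : c *: (X * Y) = (c *: X) * Y.
Proof. exact: bopP. Qed.

Lemma bop_scalerAr (c : R[i]) X Y : c *: (X * Y) = X * (c *: Y).
Proof. by apply: bopP => x; rewrite !bopE opZ. Qed.

Lemma opboundP T : exists2 C, 0 < C & opbound T C.
Proof.
case: T => f fP; have /is_bopP[_ [C hC]] := fP.
exists (`|C| + 1) => [|x]; first by rewrite ltr_wpDl.
apply: (@le_trans _ _ (C * rnorm x)).
  by rewrite -lecR rmorphM /= -!rnormE.
by rewrite ler_wpM2r ?rnorm_ge0//; apply: le_trans (ler_norm C) _; rewrite lerDl.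
Qed.

Lemma opbound_le T (c d : R) : c <= d -> opbound T c -> opbound T d.
Proof.
by move=> cd Tc x; apply: le_trans (Tc x) _; rewrite ler_wpM2r ?rnorm_ge0.
Qed.

Lemma opboundD T S (c d : R) : opbound T c -> opbound S d -> opbound (T + S) (c + d).
Proof.
by move=> Tc Sd x; rewrite bopDE mulrDl (le_trans (rnormD _ _))// lerD.
Qed.

Lemma opboundN T (c : R) : opbound T c -> opbound (- T) c.
Proof. by move=> Tc x; rewrite bopNE rnormN. Qed.

Lemma opboundM T S (c d : R) : 0 <= c ->
  opbound T c -> opbound S d -> opbound (T * S) (c * d).
Proof.
move=> c0 Tc Sd x; rewrite bopME (le_trans (Tc _))// -mulrA ler_wpM2l//.
Qed.

(** * Self-adjoint operators and their order *)

(** Polarization: the quadratic form at [x + y] and at [x + i y] recovers the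
    sesquilinear form. *)
Lemma selfadjointP T : (forall x, complex.Im (inner (T x) x) = 0) -> selfadjoint T.
Proof.
move=> T0 x y; rewrite [RHS]innerC.
have := T0 (x + y); rewrite opD innerDl !innerDr !raddfD /= !T0 add0r addr0.
have := T0 (x + 'i *: y); rewrite opD opZ innerDl !innerDr !innerZl !innerZr.
rewrite !raddfD /= T0.
have := T0 y; case: (inner (T y) y) => y1 y2 /= ->.
case: (inner (T x) y) => a b; case: (inner (T y) x) => c d /=.
move=> h1 h2; apply/eqP; rewrite eq_complex /=; apply/andP; split; apply/eqP; lra.
Qed.

Lemma rinner_selfadjoint T x y : selfadjoint T -> rinner (T x) y = rinner x (T y).
Proof. by move=> sT; rewrite /rinner sT. Qed.

Lemma inner_selfadjoint T x : selfadjoint T -> inner (T x) x = (rinner (T x) x)%:C.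
Proof.
move=> sT; have := sT x x; rewrite [RHS]innerC /rinner /=.
by case: (inner (T x) x) => a b [/= h]; congr (_ +i* _); lra.
Qed.

(** On a complex space, self-adjointness is part of positivity: the form is
    real-valued. *)
Lemma positiveP T : positive T <-> selfadjoint T /\ forall x, 0 <= rinner (T x) x.
Proof.
split=> [T0|[sT T0] x]; last by rewrite inner_selfadjoint// ler0c.
split; first by apply: selfadjointP => x; rewrite ger0_Im.
by move=> x; have := T0 x; rewrite lecE => /andP[].
Qed.

Lemma selfadjoint0 : selfadjoint (0 : 'B(H)).
Proof. by move=> x y; rewrite bop0E !(linear0l, linear0r). Qed.

Lemma selfadjoint1 : selfadjoint (1 : 'B(H)).
Proof. by []. Qed.

Lemma selfadjointD S T : selfadjoint S -> selfadjoint T -> selfadjoint (S + T).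
Proof. by move=> sS sT x y; rewrite !bopE innerDl innerDr sS sT. Qed.

Lemma selfadjointN T : selfadjoint T -> selfadjoint (- T).
Proof. by move=> sT x y; rewrite !bopE innerNl innerNr sT. Qed.

Lemma selfadjointB S T : selfadjoint S -> selfadjoint T -> selfadjoint (S - T).
Proof. by move=> sS sT; apply: selfadjointD => //; apply: selfadjointN. Qed.

Lemma selfadjointZ a T : selfadjoint T -> selfadjoint (a%:C *: T).
Proof.
by move=> sT x y; rewrite !bopE innerZl innerZr sT conjc_real.
Qed.

Lemma selfadjoint_scalar a : selfadjoint (a%:C *: (1 : 'B(H))).
Proof. exact/selfadjointZ/selfadjoint1. Qed.

Lemma selfadjoint_conj A T : selfadjoint A -> selfadjoint T -> selfadjoint (A * T * A).
Proof. by move=> sA sT x y; rewrite !bopE sA sT sA. Qed.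

Lemma selfadjointX T n : selfadjoint T -> selfadjoint (T ^+ n).
Proof.
move=> sT; elim: n => [|n ih] x y; first by rewrite expr0.
by rewrite {1}exprS exprSr !bopE sT ih.
Qed.

Lemma op_leP S T : S ⪯ T <->
  [/\ selfadjoint S, selfadjoint T & forall x, rinner (S x) x <= rinner (T x) x].
Proof.
split=> -[sS sT ST]; split=> //.
  by move=> x; have [_ /(_ x)] := (positiveP _).1 ST; rewrite bopBE rinnerBl subr_ge0.
apply/positiveP; split; first exact: selfadjointB.
by move=> x; rewrite bopBE rinnerBl subr_ge0.
Qed.

Lemma rinner_scalar a x : rinner ((a%:C *: (1 : 'B(H))) x) x = a * rnorm x ^+ 2.
Proof. by rewrite !bopE rinnerZl rinnerxx. Qed.

Lemma op_le_trans S T U : S ⪯ T -> T ⪯ U -> S ⪯ U.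
Proof.
move=> /op_leP[sS _ ST] /op_leP[_ sU TU]; apply/op_leP; split=> // x.
exact: le_trans (ST x) (TU x).
Qed.

Lemma op_leD S T S' T' : S ⪯ T -> S' ⪯ T' -> S + S' ⪯ T + T'.
Proof.
move=> /op_leP[sS sT ST] /op_leP[sS' sT' ST']; apply/op_leP.
by split=> [||x]; [exact: selfadjointD|exact: selfadjointD|rewrite !bopDE !rinnerDl lerD].
Qed.

Lemma op_le_conj A S T : selfadjoint A -> S ⪯ T -> A * S * A ⪯ A * T * A.
Proof.
move=> sA /op_leP[sS sT ST]; apply/op_leP; split; try exact: selfadjoint_conj.
by move=> x; rewrite !bopE !(rinner_selfadjoint _ x sA).
Qed.

(** The Cauchy-Schwarz inequality for the form of [S], between [x] and
    [S x]. *)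
Lemma positive_sqr_le S (K : R) x : 0 < K -> selfadjoint S ->
  (forall y, 0 <= rinner (S y) y <= K * rnorm y ^+ 2) ->
  rnorm (S x) ^+ 2 <= K * rinner (S x) x.
Proof.
move=> K0 sS S0K.
(* [K ^ -1] minimizes the form along [x - t S x] once [<S S x, S x>] is
   replaced with its bound [K |S x| ^ 2]. *)
have /andP[+ _] := S0K (x - K^-1%:C *: S x).
have /andP[_ SSx] := S0K (S x).
rewrite opB opZ rinnerBl !rinnerBr !rinnerZl !rinnerZr.
rewrite (rinner_selfadjoint (S x) x sS) !rinnerxx.
have : K^-1 * (K^-1 * rinner (S (S x)) (S x)) <= K^-1 * rnorm (S x) ^+ 2.
  by rewrite ler_pM2l ?invr_gt0// ler_pdivrMl.
move=> h1 h2; rewrite -ler_pdivrMl//; lra.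
Qed.

(** The norm of a self-adjoint operator is its numerical radius: the operator
    [T + e] lies between [0] and [2 e], and [positive_sqr_le] applied to it
    expands to [|T x| ^ 2 <= e ^ 2 |x| ^ 2]. *)
Lemma opbound_selfadjoint T (e : R) : 0 <= e -> selfadjoint T ->
  (forall y, `|rinner (T y) y| <= e * rnorm y ^+ 2) -> opbound T e.
Proof.
rewrite le_eqVlt => /predU1P[<-|e0] sT Te x; last first.
  apply: rnorm_le_sqr; first by rewrite mulr_ge0 ?rnorm_ge0// ltW.
  have sS : selfadjoint (T + e%:C *: (1 : 'B(H))) by apply/selfadjointD/selfadjoint_scalar.
  have := @positive_sqr_le (T + e%:C *: (1 : 'B(H))) (2 * e) x _ sS.
  have -> : rnorm ((T + e%:C *: (1 : 'B(H))) x) ^+ 2 =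
            rnorm (T x) ^+ 2 + 2 * e * rinner (T x) x + e ^+ 2 * rnorm x ^+ 2.
    rewrite -rinnerxx !bopE rinnerDl !rinnerDr !rinnerZl !rinnerZr !rinnerxx.
    by rewrite (rinnerC x); ring.
  have -> : rinner ((T + e%:C *: (1 : 'B(H))) x) x = rinner (T x) x + e * rnorm x ^+ 2.
    by rewrite bopDE rinnerDl rinner_scalar.
  rewrite exprMn => h.
  suff : rnorm (T x) ^+ 2 + 2 * e * rinner (T x) x + e ^+ 2 * rnorm x ^+ 2
     <= 2 * e * (rinner (T x) x + e * rnorm x ^+ 2) by nra.
  apply: h; first lra.
  move=> y; rewrite bopDE rinnerDl rinner_scalar; have := Te y; rewrite ler_norml; lra.
have h : forall y, rinner (T y) y = 0.
  by move=> y; apply/eqP; rewrite -normr_le0 (le_trans (Te y))// mul0r.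
have := @positive_sqr_le T 1 x ltr01 sT; rewrite h mulr0 mul0r.
move=> h2; apply: rnorm_le_sqr => //; rewrite expr0n /=; apply: h2 => y.
by rewrite h lexx mul1r exprn_ge0 ?rnorm_ge0.
Qed.

End RealHilbert.

(** * Norm convergence of operators *)

Section OperatorConvergence.
Variables (R : realType) (H : hilbertType R).
Implicit Types (x y z : H) (a : R) (X Y Z T S D : 'B(H)).

Lemma rnormZc (c : R[i]) x : rnorm (c *: x) = complex.Re `|c| * rnorm x.
Proof. by rewrite [LHS]/rnorm normrZ rnormE mulrC Re_mulC mulrC. Qed.

Lemma rnorm_small_eq0 x : (forall e : R, 0 < e -> rnorm x <= e) -> x = 0.
Proof.
move=> h; apply/eqP; rewrite -rnorm_eq0 eq_le rnorm_ge0 andbT.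
by apply/ler_addgt0Pl => e e0; rewrite addr0 h.
Qed.

Lemma hilbert_complete (u : nat -> H) :
  (forall e : R, 0 < e -> exists N, forall n m, (N <= n)%N -> (N <= m)%N ->
    rnorm (u n - u m) <= e) ->
  exists l, forall e : R, 0 < e -> \forall n \near \oo, rnorm (u n - l) <= e.
Proof.
move=> uC; have : cauchy (u @ \oo).
  apply/cauchyP => e e0.
  have eE : e = (complex.Re e)%:C by rewrite RRe_real// gtr0_real.
  have e0' : 0 < complex.Re e by rewrite -ltcR -eE.
  have [N NP] := uC (complex.Re e / 2) ltac:(by rewrite divr_gt0).
  exists (u N); exists N => // n /= Nn.
  rewrite -ball_normE /= rnormE eE ltcR; apply: le_lt_trans (NP _ _ _ _) _ => //.
  by rewrite ltr_pdivrMr// ltr_pMr// ltr1n.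
move=> /cauchy_cvg /cvg_ex[l /cvgrPdist_le ul]; exists l => e e0.
have := ul e%:C ltac:(by rewrite ltcR).
by apply: filterS => n; rewrite rnormE lecR rnorm_distrC.
Qed.

Definition op_cvg (T : nat -> 'B(H)) L :=
  forall e : R, 0 < e -> \forall n \near \oo, opbound (T n - L) e.

Lemma opbound_eq0 T : (forall e : R, 0 < e -> opbound T e) -> T = 0.
Proof.
move=> Te; apply: bopP => x; rewrite bop0E; apply: rnorm_small_eq0 => e e0.
have x0 : 0 < rnorm x + 1 by rewrite ltr_wpDl ?rnorm_ge0.
apply: le_trans (Te (e / (rnorm x + 1)) _ x) _; first by rewrite divr_gt0.
by rewrite mulrAC ler_pdivrMr// ler_pM2l// lerDl.
Qed.

Lemma op_le_anti S T : S ⪯ T -> T ⪯ S -> S = T.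
Proof.
move=> /op_leP[sS sT ST] /op_leP[_ _ TS]; apply/eqP; rewrite -subr_eq0; apply/eqP.
have h : opbound (S - T) 0.
  apply: opbound_selfadjoint => //; first exact: selfadjointB.
  move=> y; rewrite mul0r bopBE rinnerBl normr_le0 subr_eq0 eq_le ST TS//.
by apply: opbound_eq0 => e /ltW e0; exact: opbound_le h.
Qed.

Lemma op_cvg_unique (T : nat -> 'B(H)) L K : op_cvg T L -> op_cvg T K -> L = K.
Proof.
move=> TL TK; apply/eqP; rewrite -subr_eq0; apply/eqP/opbound_eq0 => e e0.
have e2 : 0 < e / 2 by rewrite divr_gt0.
have [n [hL hK]] := filter_ex (filterI (TL _ e2) (TK _ e2)).
have -> : L - K = (T n - K) - (T n - L) by rewrite opprB [RHS]addrC subrKA.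
by rewrite [e]splitr; apply: opboundD => //; apply: opboundN.
Qed.

Lemma op_cvg_cst T : op_cvg (fun=> T) T.
Proof.
move=> e e0; apply: nearW => n x; rewrite subrr bop0E.
by rewrite /rnorm normr0 mulr_ge0 ?rnorm_ge0// ltW.
Qed.

Lemma op_cvgD (T S : nat -> 'B(H)) L K : op_cvg T L -> op_cvg S K ->
  op_cvg (fun n => T n + S n) (L + K).
Proof.
move=> TL SK e e0; have e2 : 0 < e / 2 by rewrite divr_gt0.
apply: filterS2 (TL _ e2) (SK _ e2) => n hL hK.
by rewrite opprD addrACA [e]splitr; apply: opboundD.
Qed.

Lemma op_cvgM (T S : nat -> 'B(H)) L K : op_cvg T L -> op_cvg S K ->
  op_cvg (fun n => T n * S n) (L * K).
Proof.
move=> TL SK e e0.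
have [C C0 LC] := opboundP L; have [c c0 Kc] := opboundP K.
have hT : 0 < e / 2 / (c + 1) by rewrite !divr_gt0// addr_gt0.
have hS : 0 < e / 2 / C by rewrite !divr_gt0.
apply: filterS3 (TL _ hT) (SK _ hS) (SK _ ltr01) => n h1 h2 h3.
have -> : T n * S n - L * K = (T n - L) * S n + L * (S n - K).
  by rewrite mulrBl mulrBr addrA subrK.
have -> : e = e / 2 / (c + 1) * (c + 1) + C * (e / 2 / C).
  by field; rewrite !lt0r_neq0 ?addr_gt0.
apply: opboundD; apply: opboundM => //; [exact: ltW| |exact: ltW].
by rewrite -[S n](subrK K) addrC; apply: opboundD.
Qed.

(** The limit is built pointwise. It is a uniform limit because the Cauchy bound
    for [T n x - T m x] survives as [m] goes to infinity. *)
Lemma op_complete (T : nat -> 'B(H)) :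
  (forall e : R, 0 < e -> exists N, forall n m, (N <= n)%N -> (N <= m)%N ->
    opbound (T n - T m) e) ->
  exists L, op_cvg T L.
Proof.
move=> TC.
have /choice[f fP] : forall x, exists l,
    forall e : R, 0 < e -> \forall n \near \oo, rnorm (T n x - l) <= e.
  move=> x; apply: hilbert_complete => e e0.
  have x0 : 0 < rnorm x + 1 by rewrite ltr_wpDl ?rnorm_ge0.
  have [N NP] := TC (e / (rnorm x + 1)) ltac:(by rewrite divr_gt0).
  exists N => n m Nn Nm; apply: le_trans (NP n m Nn Nm x) _.
  by rewrite mulrAC ler_pdivrMr// ler_pM2l// lerDl.
have fT (e : R) : 0 < e -> exists N, forall n, (N <= n)%N ->
    forall x, rnorm (T n x - f x) <= e * rnorm x.
  move=> e0; have [N NP] := TC e e0; exists N => n Nn x.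
  apply/ler_addgt0Pr => d d0.
  have [m [Nm hm]] := filter_ex (filterI (nbhs_infty_ge N) (fP x d d0)).
  rewrite -[T n x - _](subrKA (T m x)) (le_trans (rnormD _ _))// lerD//.
  exact: (NP n m Nn Nm x).
have fbop : f \in @is_bop R H.
  apply/is_bopP; split=> [c x y|].
    apply/eqP; rewrite -subr_eq0; apply/eqP/rnorm_small_eq0 => e e0.
    pose d := e / (complex.Re `|c| + 2).
    have c0 : 0 <= complex.Re `|c| by rewrite -ler0c RRe_real// ger0_real.
    have d0 : 0 < d by rewrite divr_gt0// ltr_wpDl.
    have [n [[h1 h2] h3]] := filter_ex (filterI (filterI (fP x d d0) (fP y d d0))
      (fP (c *: x + y) d d0)).
    have -> : f (c *: x + y) - (c *: f x + f y) =
        c *: (T n x - f x) + (T n y - f y) - (T n (c *: x + y) - f (c *: x + y)).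
      by rewrite opD opZ scalerBr [X in _ = X - _]addrACA -opprD opprB [RHS]addrC subrKA.
    apply: le_trans (rnormB _ _) _; apply: le_trans (lerD (rnormD _ _) h3) _.
    rewrite rnormZc.
    have -> : e = complex.Re `|c| * d + d + d.
      by rewrite /d; field; rewrite gt_eqF// ltr_wpDl.
    by rewrite lerD2r lerD// ler_wpM2l.
  have [N /(_ N (leqnn N)) hN] := fT 1 ltr01.
  have [C C0 hC] := opboundP (T N).
  exists (C + 1) => x; rewrite !rnormE -rmorphM lecR.
  rewrite -[f x](subrK (T N x)) (le_trans (rnormD _ _))// addrC mulrDl lerD//.
  by rewrite rnorm_distrC.
exists (Bop fbop) => e e0; have [N NP] := fT e e0.
by exists N => // n /= Nn x; exact: NP.
Qed.

Lemma rinner_cvg_le (T : nat -> 'B(H)) L x (c : R) : op_cvg T L ->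
  (\forall n \near \oo, c <= rinner (T n x) x) -> c <= rinner (L x) x.
Proof.
move=> TL Tc; apply/ler_addgt0Pr => e e0.
have x0 : 0 < rnorm x ^+ 2 + 1 by rewrite ltr_wpDl ?sqr_ge0.
have d0 : 0 < e / (rnorm x ^+ 2 + 1) by rewrite divr_gt0.
have [n [hn hc]] := filter_ex (filterI (TL _ d0) Tc).
apply: le_trans hc _; rewrite -lerBlDl -rinnerBl -bopBE.
apply: le_trans (ler_norm _) _; apply: le_trans (normr_rinner_le (ltW d0) (hn x)) _.
by rewrite mulrAC ler_pdivrMr// ler_pM2l// lerDl.
Qed.

Lemma op_cvgZ (c : R[i]) (T : nat -> 'B(H)) L :
  op_cvg T L -> op_cvg (fun n => c *: T n) (c *: L).
Proof.
move=> /(op_cvgM (op_cvg_cst (c *: (1 : 'B(H))))).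
by under eq_fun do rewrite -bop_scalerAl mul1r; rewrite -bop_scalerAl mul1r.
Qed.

Lemma op_cvgB (T S : nat -> 'B(H)) L K : op_cvg T L -> op_cvg S K ->
  op_cvg (fun n => T n - S n) (L - K).
Proof.
move=> TL /(op_cvgZ (-1)); rewrite scaleN1r.
by under eq_fun do rewrite scaleN1r; exact: op_cvgD.
Qed.

Lemma rinner_cvg0 (T : nat -> 'B(H)) L x : op_cvg T L ->
  (forall n, rinner (T n x) x = 0) -> rinner (L x) x = 0.
Proof.
move=> TL T0; apply/eqP; rewrite eq_le -oppr_ge0 -rinnerNl; apply/andP; split.
  rewrite -[- _]scaleN1r -bopZE; apply: (rinner_cvg_le (op_cvgZ (-1) TL)).
  by apply: nearW => n; rewrite bopZE scaleN1r rinnerNl T0 oppr0.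
by apply: (rinner_cvg_le TL); apply: nearW => n; rewrite T0.
Qed.

(** The imaginary part of a quadratic form is a real part of the form of
    ['i *: T], so it passes to the limit as [rinner] does. *)
Lemma selfadjoint_cvg (T : nat -> 'B(H)) L : op_cvg T L ->
  (forall n, selfadjoint (T n)) -> selfadjoint L.
Proof.
move=> TL sT; apply: selfadjointP => x.
have ImE (y : H) : complex.Im (inner y x) = - rinner ('i *: y) x.
  by rewrite /rinner innerZl; case: (inner y x) => a b /=; ring.
rewrite ImE -bopZE (rinner_cvg0 (op_cvgZ 'i TL)) ?oppr0// => n.
by apply/eqP; rewrite bopZE -oppr_eq0 -ImE inner_selfadjoint.
Qed.

(** * Invertibility *)

Lemma opboundX D (q : R) n : 0 <= q -> opbound D q -> opbound (D ^+ n) (q ^+ n).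
Proof.
move=> q0 Dq; elim: n => [|n ih]; first by move=> x; rewrite expr0 bop1E mul1r.
by rewrite !exprS; apply: opboundM.
Qed.

Lemma expr_cvg0 (q : R) : 0 <= q < 1 -> forall e : R, 0 < e ->
  \forall n \near \oo, q ^+ n <= e.
Proof.
move=> /andP[q0 q1] e e0.
have /cvgrPdist_le/(_ e e0) : q ^+ n @[n --> \oo] --> (0 : R).
  by apply: cvg_expr; rewrite ger0_norm.
by apply: filterS => n; rewrite sub0r normrN ger0_norm// exprn_ge0.
Qed.

(** The inverse is the sum of the Neumann series of [D], whose partial sums are
    Cauchy by the geometric bound. *)
Lemma invertible_subr D (q : R) : 0 <= q < 1 -> opbound D q -> invertible (1 - D).
Proof.
move=> /[dup] q01 /andP[q0 q1] Dq.
have q1' : 0 < 1 - q by rewrite subr_gt0.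
pose T n := \sum_(k < n) D ^+ k.
have TmT m k : opbound (T (m + k)%N - T m) ((q ^+ m - q ^+ (m + k)) / (1 - q)).
  elim: k => [|k ih].
    by move=> x; rewrite addn0 !subrr mul0r bop0E /rnorm normr0 mul0r.
  have -> : T (m + k.+1)%N - T m = (T (m + k)%N - T m) + D ^+ (m + k).
    by rewrite addnS /T big_ord_recr /= addrAC.
  have -> : (q ^+ m - q ^+ (m + k.+1)) / (1 - q) =
     (q ^+ m - q ^+ (m + k)) / (1 - q) + q ^+ (m + k).
    by rewrite addnS exprS; field; rewrite lt0r_neq0.
  by apply: opboundD => //; apply: opboundX.
have TmT' m k : opbound (T (m + k)%N - T m) (q ^+ m / (1 - q)).
  apply: opbound_le (TmT m k); rewrite ler_pM2r ?invr_gt0//.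
  by rewrite gerBl exprn_ge0.
have [L TL] : exists L, op_cvg T L.
  apply: op_complete => e e0.
  have e2 : 0 < e / 2 * (1 - q) by rewrite mulr_gt0// divr_gt0.
  have [N [_ hN]] := filter_ex (filterI (nbhs_infty_ge 0%N) (expr_cvg0 q01 e2)).
  have {}hN k : opbound (T (N + k)%N - T N) (e / 2).
    by apply: opbound_le (TmT' N k); rewrite ler_pdivrMr.
  exists N => n m Nn Nm.
  rewrite -(subnKC Nn) -(subnKC Nm) -[X in X - _](subrK (T N)) -addrA [e]splitr.
  by apply: opboundD => //; rewrite -opprB; apply: opboundN.
have DT : op_cvg (fun n => 1 - D ^+ n) (1 : 'B(H)).
  move=> e e0; apply: filterS (expr_cvg0 q01 e0) => n hn.
  rewrite addrAC subrr sub0r; apply: opboundN.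
  exact: opbound_le hn (opboundX n q0 Dq).
have c1 n : (1 - D) * T n = 1 - D ^+ n.
  by rewrite -[RHS]opprB subrX1 -mulNr opprB.
have c2 n : T n * (1 - D) = 1 - D ^+ n.
  rewrite -c1; symmetry; apply: commr_sum => k _; apply: commrX.
  by apply: commr_sym; apply: commrB; [exact: commr1|].
have cD := op_cvg_cst (1 - D).
exists L; split; apply: (@op_cvg_unique (fun n => 1 - D ^+ n)) => //.
  by rewrite -(funext c1); exact: op_cvgM.
by rewrite -(funext c2); exact: op_cvgM.
Qed.

Lemma invertibleM X Y : invertible X -> invertible Y -> invertible (X * Y).
Proof.
move=> [X' [X1 X2]] [Y' [Y1 Y2]]; exists (Y' * X'); split.
  by rewrite mulrA -(mulrA X) Y1 mulr1.
by rewrite mulrA -(mulrA Y') X2 mulr1.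
Qed.

Lemma invertibleZ (c : R[i]) X : c != 0 -> invertible X -> invertible (c *: X).
Proof.
move=> c0 [Y [h1 h2]]; exists (c^-1 *: Y).
by rewrite -!bop_scalerAl -!bop_scalerAr h1 h2 !scalerA mulfV// mulVf// scale1r.
Qed.

Lemma invertible_comm X Y : X * Y = Y * X -> invertible (X * Y) -> invertible X.
Proof.
move=> XY [Z [h1 h2]]; exists (Y * Z); split; first by rewrite mulrA.
have -> : Y * Z = Z * Y; last by rewrite -mulrA -XY.
rewrite -[LHS]mul1r -[RHS]mulr1 -{1}h2 -h1 !mulrA; congr (_ * _ * _).
by rewrite -!mulrA XY.
Qed.

(** If [T <= C], then [1 - T / C] lies between [0] and [1 - c / C], so that its
    norm is less than [1] and the Neumann series inverts [T / C]. *)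
Lemma coercive_invertible T (c : R) : 0 < c -> selfadjoint T ->
  (forall x, c * rnorm x ^+ 2 <= rinner (T x) x) -> invertible T.
Proof.
move=> c0 sT Tc.
have [C0 C00 TC0] := opboundP T.
(* Adding [c] makes [c / C <= 1], so that [q] is nonnegative. *)
pose C := C0 + c.
have CP : 0 < C by rewrite addr_gt0.
have TC y : rinner (T y) y <= C * rnorm y ^+ 2.
  apply: le_trans (ler_norm _) _; apply: normr_rinner_le; first exact: ltW.
  by apply: opbound_le TC0 y; rewrite lerDl ltW.
pose q := 1 - c / C.
have q01 : 0 <= q < 1.
  rewrite subr_ge0 ler_pdivrMr// mul1r lerDr ltW//=.
  by rewrite gtrBl divr_gt0.
pose D := 1 - C^-1%:C *: T.
have Dq : opbound D q.
  apply: opbound_selfadjoint; [by case/andP: q01|exact/selfadjointB/selfadjointZ|] => y.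
  rewrite /D bopBE bop1E bopZE rinnerBl rinnerxx rinnerZl.
  have h1 : c / C * rnorm y ^+ 2 <= C^-1 * rinner (T y) y.
    by rewrite mulrAC [leRHS]mulrC ler_pM2r ?invr_gt0.
  have h2 : C^-1 * rinner (T y) y <= rnorm y ^+ 2 by rewrite ler_pdivrMl.
  by rewrite ger0_norm ?subr_ge0// /q mulrBl mul1r lerD2l lerN2.
have := invertibleZ _ (invertible_subr q01 Dq).
move=> /(_ C%:C); by rewrite /D subKr scalerA -rmorphM mulfV ?lt0r_neq0 ?ltcR// scale1r; apply.
Qed.

(** A converse of [coercive_invertible]. An inverse bounds [|x|] by [|T x|], and
    [positive_sqr_le] bounds [|T x| ^ 2] by the form of [T]. *)
Lemma invertible_coercive T : positive T -> invertible T ->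
  exists2 c : R, 0 < c & forall x, c * rnorm x ^+ 2 <= rinner (T x) x.
Proof.
move=> /positiveP[sT T0] [S [_ ST]].
have [C C0 TC] := opboundP T; have [K K0 SK] := opboundP S.
exists ((K ^+ 2 * C)^-1) => [|x]; first by rewrite invr_gt0 mulr_gt0// exprn_gt0.
rewrite ler_pdivrMl ?mulr_gt0// ?exprn_gt0// -mulrA.
have -> : rnorm x ^+ 2 = rnorm (S (T x)) ^+ 2 by rewrite -bopME ST.
apply: (@le_trans _ _ (K ^+ 2 * rnorm (T x) ^+ 2)).
  by rewrite -exprMn ler_sqr ?nnegrE ?rnorm_ge0// mulr_ge0 ?rnorm_ge0// ltW.
rewrite ler_wpM2l ?sqr_ge0//; apply: positive_sqr_le => // y.
rewrite T0 /=; apply: le_trans (ler_norm _) _.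
by apply: normr_rinner_le; [exact: ltW|exact: TC].
Qed.

End OperatorConvergence.

(** * Polynomials of a self-adjoint operator *)

Section OperatorPolynomials.
Variables (R : realType) (H : hilbertType R).
Implicit Types (x y z : H) (a : R) (X Y Z T S D : 'B(H)).
Implicit Types (P Q : {poly R}) (p q : {poly R[i]}).

(** Complex coefficients are needed to split a real polynomial into linear
    factors. *)
Definition op_hornerc (p : {poly R[i]}) X : 'B(H) :=
  \sum_(i < size p) p`_i *: X ^+ i.

Lemma op_hornerc_widen n (p : {poly R[i]}) X : (size p <= n)%N ->
  op_hornerc p X = \sum_(i < n) p`_i *: X ^+ i.
Proof.
move=> pn; rewrite /op_hornerc (big_ord_widen n (fun i => p`_i *: X ^+ i))//.
rewrite big_mkcond; apply: eq_bigr => i _; case: ltnP => // h.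
by rewrite nth_default// scale0r.
Qed.

Lemma op_hornercD p q X : op_hornerc (p + q) X = op_hornerc p X + op_hornerc q X.
Proof.
pose n := maxn (size p) (size q).
rewrite !(@op_hornerc_widen n) ?leq_maxl ?leq_maxr ?size_polyD// -big_split /=.
by apply: eq_bigr => i _; rewrite coefD scalerDl.
Qed.

Lemma op_hornercZ c p X : op_hornerc (c *: p) X = c *: op_hornerc p X.
Proof.
rewrite (op_hornerc_widen _ (size_scale_leq c p)) scaler_sumr.
by apply: eq_bigr => i _; rewrite coefZ scalerA.
Qed.

Lemma op_hornercC c X : op_hornerc c%:P X = c *: (1 : 'B(H)).
Proof.
by rewrite (op_hornerc_widen _ (size_polyC_leq1 c)) big_ord1 coefC expr0.
Qed.

Lemma op_hornercMX p X : op_hornerc (p * 'X) X = op_hornerc p X * X.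
Proof.
have h : (size (p * 'X)%R <= (size p).+1)%N.
  by apply: leq_trans (size_polyMleq _ _) _; rewrite size_polyX addn2.
rewrite (op_hornerc_widen _ h) big_ord_recl coefMX /= scale0r add0r mulr_suml.
by apply: eq_bigr => i _; rewrite coefMX /= exprSr bop_scalerAl.
Qed.

Lemma op_hornercM p q X : op_hornerc (p * q) X = op_hornerc p X * op_hornerc q X.
Proof.
elim/poly_ind: q => [|q c ih].
  by rewrite mulr0 /op_hornerc size_poly0 big_ord0 mulr0.
rewrite mulrDr mulrA [p * c%:P]mulrC mul_polyC !(op_hornercD, op_hornercMX) ih.
by rewrite op_hornercZ op_hornercC mulrDr mulrA -bop_scalerAr mulr1.
Qed.

Lemma op_hornercX X : op_hornerc 'X X = X.
Proof. by rewrite -['X]mul1r op_hornercMX op_hornercC scale1r mul1r. Qed.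

Lemma op_hornerE P X : op_horner P X = op_hornerc (map_poly (real_complex R) P) X.
Proof.
rewrite /op_hornerc /op_horner size_map_poly.
by apply: eq_bigr => i _; rewrite coef_map.
Qed.

Lemma op_hornerD P Q X : op_horner (P + Q) X = op_horner P X + op_horner Q X.
Proof. by rewrite !op_hornerE rmorphD op_hornercD. Qed.

Lemma op_hornerM P Q X : op_horner (P * Q) X = op_horner P X * op_horner Q X.
Proof. by rewrite !op_hornerE rmorphM op_hornercM. Qed.

Lemma op_hornerC a X : op_horner a%:P X = a%:C *: (1 : 'B(H)).
Proof. by rewrite op_hornerE map_polyC op_hornercC. Qed.

Lemma op_hornerX X : op_horner 'X X = X.
Proof. by rewrite op_hornerE map_polyX op_hornercX. Qed.

Lemma op_hornerZ a P X : op_horner (a *: P) X = a%:C *: op_horner P X.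
Proof. by rewrite -mul_polyC op_hornerM op_hornerC -bop_scalerAl mul1r. Qed.

Lemma op_hornerN P X : op_horner (- P) X = - op_horner P X.
Proof. by rewrite -scaleN1r op_hornerZ rmorphN1 scaleN1r. Qed.

Lemma op_hornerB P Q X : op_horner (P - Q) X = op_horner P X - op_horner Q X.
Proof. by rewrite op_hornerD op_hornerN. Qed.

Lemma selfadjoint_horner P X : selfadjoint X -> selfadjoint (op_horner P X).
Proof.
move=> sX; rewrite /op_horner; elim/big_ind: _ => //; first exact: selfadjoint0.
  exact: selfadjointD.
by move=> i _; apply/selfadjointZ/selfadjointX.
Qed.

(** For [z = a + i b], the product of [X - z] and [X - conj z] is
    [(X - a) ^ 2 + b ^ 2], which is bounded below by [b ^ 2]. *)
Lemma invertible_nonreal X (z : R[i]) : selfadjoint X -> complex.Im z != 0 ->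
  invertible (op_hornerc ('X - z%:P) X).
Proof.
case: z => a b /= sX b0.
pose Q : {poly R} := ('X - a%:P) * ('X - a%:P) + b%:P * b%:P.
apply: (@invertible_comm _ _ _ (op_hornerc ('X - (a -i* b)%:P) X)).
  by rewrite -!op_hornercM mulrC.
rewrite -op_hornercM.
have -> : ('X - (a +i* b)%:P) * ('X - (a -i* b)%:P) = map_poly (real_complex R) Q.
  rewrite /Q rmorphD !rmorphM rmorphB /= map_polyX !map_polyC.
  have -> : (a +i* b)%:P = (a%:C)%:P + ('i%C)%:P * (b%:C)%:P.
    by rewrite -rmorphM -rmorphD; congr _%:P; simpc.
  have -> : (a -i* b)%:P = (a%:C)%:P - ('i%C)%:P * (b%:C)%:P.
    by rewrite -rmorphM -rmorphB; congr _%:P; simpc.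
  have : ('i%C : R[i])%:P ^+ 2 = -1 by rewrite -rmorphXn /= sqr_i rmorphN1.
  move: ('i%C)%:P (a%:C)%:P (b%:C)%:P => I A B I2.
  have -> : B * B = - (I ^+ 2) * (B * B) by rewrite I2 opprK mul1r.
  ring.
rewrite -op_hornerE; apply: (@coercive_invertible _ _ _ (b ^+ 2)).
- by rewrite exprn_even_gt0.
- exact: selfadjoint_horner.
- move=> x; rewrite op_hornerD -polyCM op_hornerC bopDE rinnerDl rinner_scalar.
  rewrite -expr2 lerDr op_hornerM bopME.
  rewrite rinner_selfadjoint; last exact: selfadjoint_horner.
  by rewrite rinnerxx sqr_ge0.
Qed.

(** The polynomial is a product of factors [X - z]: those with a nonreal root
    are invertible because [X] is self-adjoint, the others because their root is
    not in the spectrum. *)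
Lemma invertible_horner X P : selfadjoint X -> P != 0 ->
  (forall t, spectrum X t%:C -> P.[t] != 0) -> invertible (op_horner P X).
Proof.
move=> sX P0 Pt; rewrite op_hornerE.
set p := map_poly _ P.
have p0 : p != 0 by rewrite map_poly_eq0.
have [r pr] := closed_field_poly_normal p.
have rP (z : R[i]) : z \in r -> invertible (op_hornerc ('X - z%:P) X).
  move=> zr; have [z0|] := eqVneq (complex.Im z) 0; last exact: invertible_nonreal.
  have zE : z = (complex.Re z)%:C by case: z z0 {zr} => u v /= ->.
  have pz : root p z by rewrite pr rootZ ?lead_coef_eq0// root_prod_XsubC.
  apply: contrapT => nX; have := Pt (complex.Re z).
  rewrite -zE; case/(_ _)/negP.
    rewrite /spectrum /=; move: nX; rewrite op_hornercD op_hornercX -polyCN op_hornercC.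
    by rewrite scaleNr.
  move: pz; rewrite zE /p rootE horner_map /=.
  by rewrite -(inj_eq (@complexI R)).
rewrite pr op_hornercZ; apply: invertibleZ; first by rewrite lead_coef_eq0.
elim: r rP {pr} => [|z r ih] rP.
  by rewrite big_nil op_hornercC scale1r; exists 1; rewrite mulr1.
rewrite big_cons op_hornercM; apply: invertibleM; first by apply: rP; rewrite mem_head.
by apply: ih => w wr; apply: rP; rewrite inE wr orbT.
Qed.

(** If the greatest lower bound [l] of the form of [P(X)] is negative, then [P - l]
    is positive on the spectrum, so [P(X) - l] is invertible, hence bounded
    below by some [c > 0], and [l + c] is a larger lower bound. For a constant
    [P], the difference [P - l] could be zero and the argument would not
    start; [op_horner_ge0] treats this case. *)
Lemma op_horner_ge0_nonconst X P : selfadjoint X -> (forall c, P != c%:P) ->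
  (forall t, spectrum X t%:C -> 0 <= P.[t]) ->
  forall x, 0 <= rinner (op_horner P X x) x.
Proof.
move=> sX Pnc Pt x0; rewrite leNgt; apply/negP => T0.
set T := op_horner P X in T0.
have sT : selfadjoint T by exact: selfadjoint_horner.
pose E := [set c : R | forall x, c * rnorm x ^+ 2 <= rinner (T x) x].
have E0 : ubound E 0.
  move=> c /(_ x0) Ec; rewrite leNgt; apply/negP => c0.
  have : 0 <= c * rnorm x0 ^+ 2 by rewrite mulr_ge0 ?sqr_ge0// ltW.
  by rewrite leNgt (le_lt_trans Ec).
have [C C0 TC] := opboundP T.
have EC : E (- C).
  move=> x; rewrite mulNr; have := normr_rinner_le (ltW C0) (TC x).
  by rewrite ler_norml => /andP[].
have supE : has_sup E by split; [exists (- C)|exists 0].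
set l := sup E.
have El : E l.
  move=> x; have [->|xn0] := eqVneq x 0.
    by rewrite op0 /rinner linear0l /rnorm normr0 expr0n mulr0.
  have x2 : 0 < rnorm x ^+ 2 by rewrite exprn_even_gt0// rnorm_eq0.
  rewrite -ler_pdivlMr//; apply: ge_sup; first by exists (- C).
  by move=> c Ec; rewrite ler_pdivlMr.
have l0 : l < 0.
  rewrite ltNge; apply/negP => l0; have := El x0; apply/negP; rewrite -ltNge.
  by apply: (lt_le_trans T0); rewrite mulr_ge0// sqr_ge0.
have iQ : invertible (op_horner (P - l%:P) X).
  apply: invertible_horner => //; first by rewrite subr_eq0.
  move=> t /Pt Pt0; rewrite !hornerE gt_eqF// subr_gt0; exact: lt_le_trans Pt0.
have pQ : positive (op_horner (P - l%:P) X).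
  apply/positiveP; split; first exact: selfadjoint_horner.
  by move=> x; rewrite op_hornerB op_hornerC bopBE rinnerBl rinner_scalar subr_ge0 El.
have [c c0 Qc] := invertible_coercive pQ iQ.
have : E (l + c).
  move=> x; have := Qc x.
  by rewrite op_hornerB op_hornerC bopBE rinnerBl rinner_scalar mulrDl -lerBrDl.
move=> /(ub_le_sup supE.2); rewrite -/l gerDl; apply/negP.
by rewrite -ltNge.
Qed.

(** If the real spectrum were empty, [op_horner_ge0_nonconst] would show that
    [X >= C + 1] for every [C], including a norm bound of [X]. *)
Lemma spectrum_nonempty X x : selfadjoint X -> x != 0 ->
  exists t, spectrum X t%:C.
Proof.
move=> sX x0; apply: contrapT => noT.
have [C C0 XC] := opboundP X.
have x2 : 0 < rnorm x ^+ 2 by rewrite exprn_even_gt0// rnorm_eq0.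
have h : 0 <= rinner (op_horner ('X - (C + 1)%:P) X x) x.
  apply: op_horner_ge0_nonconst => // [c|t st]; last by exfalso; apply: noT; exists t.
  by apply/eqP => /(congr1 (size : {poly R} -> nat)) /eqP; 
     rewrite size_XsubC size_polyC; case: (_ != _).
have := normr_rinner_le (ltW C0) (XC x); rewrite ler_norml => /andP[_].
move: h; rewrite op_hornerB op_hornerC op_hornerX bopBE rinnerBl rinner_scalar.
rewrite subr_ge0 => h1 h2.
have := le_trans h1 h2; rewrite ler_pM2r//; lra.
Qed.

Lemma op_horner_ge0 X P : selfadjoint X ->
  (forall t, spectrum X t%:C -> 0 <= P.[t]) ->
  forall x, 0 <= rinner (op_horner P X x) x.
Proof.
move=> sX Pt x; have [->|x0] := eqVneq x 0.
  by rewrite op0 /rinner linear0l.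
have [[c Pc]|Pnc] := pselect (exists c, P = c%:P).
  rewrite Pc op_hornerC rinner_scalar mulr_ge0 ?sqr_ge0//.
  by have [t /Pt] := spectrum_nonempty sX x0; rewrite Pc hornerC.
by apply: op_horner_ge0_nonconst => // c; apply/eqP => Pc; apply: Pnc; exists c.
Qed.

Lemma op_horner_le X P Q : selfadjoint X ->
  (forall t, spectrum X t%:C -> P.[t] <= Q.[t]) ->
  forall x, rinner (op_horner P X x) x <= rinner (op_horner Q X x) x.
Proof.
move=> sX PQ x; rewrite -subr_ge0 -rinnerBl -bopBE -op_hornerB.
by apply: op_horner_ge0 => // t /PQ; rewrite !hornerE subr_ge0.
Qed.

Lemma opbound_horner X P (e : R) : 0 <= e -> selfadjoint X ->
  (forall t, spectrum X t%:C -> `|P.[t]| <= e) -> opbound (op_horner P X) e.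
Proof.
move=> e0 sX Pe; apply: opbound_selfadjoint => // [|y]; first exact: selfadjoint_horner.
have eE : e * rnorm y ^+ 2 = rinner (op_horner e%:P X y) y.
  by rewrite op_hornerC rinner_scalar.
have NeE : - (e * rnorm y ^+ 2) = rinner (op_horner (- e)%:P X y) y.
  by rewrite op_hornerC rinner_scalar mulNr.
rewrite ler_norml; apply/andP; split; [rewrite NeE|rewrite eE];
  apply: op_horner_le => // t /Pe; rewrite ler_norml hornerC => /andP[]//.
Qed.

Lemma spectrum_ge X (c : R) t : selfadjoint X ->
  (forall x, c * rnorm x ^+ 2 <= rinner (X x) x) -> spectrum X t%:C -> c <= t.
Proof.
move=> sX Xc st; rewrite leNgt; apply/negP => tc; apply: st.
apply: (@coercive_invertible _ _ _ (c - t)); first by rewrite subr_gt0.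
  exact/selfadjointB/selfadjoint_scalar.
by move=> x; rewrite bopBE rinnerBl rinner_scalar mulrBl lerD2r.
Qed.

Lemma spectrum_le X (c : R) t : selfadjoint X ->
  (forall x, rinner (X x) x <= c * rnorm x ^+ 2) -> spectrum X t%:C -> t <= c.
Proof.
move=> sX Xc st; rewrite leNgt; apply/negP => tc; apply: st.
rewrite -opprB -scaleN1r; apply: invertibleZ; first by rewrite oppr_eq0 oner_eq0.
apply: (@coercive_invertible _ _ _ (t - c)); first by rewrite subr_gt0.
  exact/selfadjointB/sX/selfadjoint_scalar.
by move=> x; rewrite bopBE rinnerBl rinner_scalar mulrBl lerD2l lerN2.
Qed.

End OperatorPolynomials.

(** * Uniform polynomial approximation of power functions *)

Section UniformPolynomialApproximation.
Variable R : realType.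
Implicit Types (f g : nat -> R) (x : R).

(** The value at [x] is the mean of [g] under the binomial law of parameters [n]
    and [x]. This is de Casteljau's recursion, which conditions on the first
    trial: the moments follow by induction, without binomial coefficients. *)
Fixpoint bernstein n (g : nat -> R) : {poly R} :=
  if n is n'.+1 then 'X * bernstein n' (g \o succn) + (1 - 'X) * bernstein n' g
  else (g 0%N)%:P.

Lemma bernsteinS n g x : (bernstein n.+1 g).[x] =
  x * (bernstein n (g \o succn)).[x] + (1 - x) * (bernstein n g).[x].
Proof. by rewrite /= !hornerE. Qed.

Lemma bernstein_linear n (a : R) f g x :
  (bernstein n (fun k => a * f k + g k)).[x] =
  a * (bernstein n f).[x] + (bernstein n g).[x].
Proof.
elim: n f g => [|n ih] f g; first by rewrite !hornerC.
rewrite !bernsteinS (_ : _ \o succn = fun k => a * (f \o succn) k + (g \o succn) k)//.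
by rewrite !ih; ring.
Qed.

Lemma bernstein_cst n (a : R) x : (bernstein n (fun=> a)).[x] = a.
Proof.
elim: n => [|n ih]; first by rewrite hornerC.
by rewrite bernsteinS (_ : _ \o succn = fun=> a)// ih; ring.
Qed.

(** The second moment about an arbitrary [c]: the induction step shifts [c]. *)
Lemma bernstein_variance n (c : R) x :
  (bernstein n (fun k => (k%:R - c) ^+ 2)).[x] =
  n%:R * x * (1 - x) + (n%:R * x - c) ^+ 2.
Proof.
elim: n c => [|n ih] c; first by rewrite hornerC; ring.
rewrite bernsteinS (_ : _ \o succn = fun k => (k%:R - (c - 1)) ^+ 2).
  by rewrite !ih -natr1; ring.
by apply: funext => k /=; rewrite -natr1; congr (_ ^+ 2); ring.
Qed.

Lemma bernstein_le n f g x : 0 <= x <= 1 ->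
  (forall k, (k <= n)%N -> f k <= g k) -> (bernstein n f).[x] <= (bernstein n g).[x].
Proof.
move=> /[dup] x01 /andP[x0 x1]; elim: n f g => [|n ih] f g fg.
  by rewrite !hornerC fg.
rewrite !bernsteinS lerD// ler_wpM2l ?subr_ge0//; apply: ih => k kn /=.
  exact: fg.
by apply: fg; exact: leqW.
Qed.

(** The error is at most [L] times the mean of [|k / n - x|]. By the
    arithmetic-geometric inequality [|w| <= (w ^ 2 + d ^ 2) / (2 d)] this mean is
    at most [(V + d ^ 2) / (2 d)], where [V = x (1 - x) / n <= d ^ 2] is the
    variance of [k / n]. *)
Lemma bernstein_lipschitz (f : R -> R) (L d : R) n x :
  (forall s t, 0 <= s <= 1 -> 0 <= t <= 1 -> `|f s - f t| <= L * `|s - t|) ->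
  0 < d -> 1 <= n%:R * d ^+ 2 -> 0 <= x <= 1 ->
  `|(bernstein n (fun k => f (k%:R / n%:R))).[x] - f x| <= L * d.
Proof.
move=> fL d0 nd /[dup] x01 /andP[x0 x1].
have L0 : 0 <= L.
  have := fL 0 1; rewrite sub0r normrN normr1 mulr1 lexx ler01.
  by rewrite lexx => /(_ isT isT); exact: le_trans.
have n0 : 0 < n%:R :> R.
  have d2 : 0 < d ^+ 2 by rewrite exprn_gt0.
  by rewrite -(pmulr_lgt0 _ d2); apply: lt_le_trans nd.
pose c := L / (2 * d * n%:R ^+ 2).
pose h k := c * (k%:R - n%:R * x) ^+ 2 + L * d / 2.
have fh k : (k <= n)%N -> `|f (k%:R / n%:R) - f x| <= h k.
  move=> kn; apply: le_trans (fL _ _ _ x01) _.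
    by rewrite divr_ge0//= ler_pdivrMr// mul1r ler_nat.
  have -> : h k = L * (((k%:R / n%:R - x) ^+ 2 + d ^+ 2) / (2 * d)).
    by rewrite /h /c; field; rewrite !lt0r_neq0.
  rewrite ler_wpM2l// ler_pdivlMr ?mulr_gt0//.
  set u := _ - x; rewrite -[u ^+ 2]real_normK ?num_real//.
  have := sqr_ge0 (`|u| - d); nra.
have Bh : (bernstein n h).[x] <= L * d.
  rewrite bernstein_linear bernstein_variance subrr bernstein_cst expr0n addr0.
  have : c * (n%:R * x * (1 - x)) <= L * d / 2; last lra.
  have -> : c * (n%:R * x * (1 - x)) = L / (2 * d * n%:R) * (x * (1 - x)).
    by rewrite /c; field; rewrite !lt0r_neq0.
  apply: (@le_trans _ _ (L / (2 * d * n%:R) * 1)).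
    by rewrite ler_wpM2l ?divr_ge0 ?mulr_ge0 ?(ltW d0)//; nra.
  rewrite mulr1 ler_pdivrMr ?mulr_gt0//.
  have -> : L * d / 2 * (2 * d * n%:R) = L * (n%:R * d ^+ 2) by field.
  by rewrite ler_peMr.
have key (e : R) : `|e| = 1 ->
    e * ((bernstein n (fun k => f (k%:R / n%:R))).[x] - f x) <= L * d.
  move=> e1; apply: le_trans Bh.
  have -> : e * ((bernstein n (fun k => f (k%:R / n%:R))).[x] - f x) =
      (bernstein n (fun k => e * f (k%:R / n%:R) + (- (e * f x)))).[x].
    by rewrite bernstein_linear bernstein_cst mulrBr.
  apply: bernstein_le => // k kn; apply: le_trans (fh k kn).
  by rewrite -mulrBr (le_trans (ler_norm _))// normrM e1 mul1r.
have := key 1 (normr1 _); have := key (-1) (normrN1 _).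
by rewrite mulN1r mul1r ler_norml lerNl => -> ->.
Qed.

Lemma le0_ger_powR (r u v : R) : r <= 0 -> 0 < u -> u <= v -> v `^ r <= u `^ r.
Proof.
move=> r0 u0 uv; have v0 := lt_le_trans u0 uv.
rewrite -[r]opprK !(powRN _ (- r)) lef_pV2 ?posrE ?powR_gt0//.
by rewrite ge0_ler_powR ?nnegrE ?oppr_ge0// ltW.
Qed.

Lemma powR_MVT (p u v : R) : 0 < u -> u <= v ->
  exists2 c, u <= c <= v & v `^ p - u `^ p = p * c `^ (p - 1) * (v - u).
Proof.
move=> u0 uv.
have drv x : x \in `]u, v[ -> is_derive x 1 (@powR R ^~ p) (p * x `^ (p - 1)).
  by rewrite in_itv /= => /andP[ux _]; apply: is_derive1_powR; exact: lt_trans ux.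
have cnt : {within `[u, v], continuous (@powR R ^~ p)}.
  apply: derivable_within_continuous => x; rewrite in_itv /= => /andP[ux _].
  by apply: derivable_powR; rewrite in_itv /= andbT; exact: lt_le_trans ux.
have [c] := MVT_segment uv drv cnt.
by rewrite in_itv /= => uc; exists c.
Qed.

(** Between [u] and [v], [c ^ (p - 1)] is bounded by its larger endpoint value;
    the sum of the two values covers both signs of [p - 1]. *)
Lemma powR_lipschitz (p u v : R) : 0 < u ->
  exists L, forall s t, u <= s <= v -> u <= t <= v ->
    `|s `^ p - t `^ p| <= L * `|s - t|.
Proof.
move=> u0; pose K := u `^ (p - 1) + v `^ (p - 1).
have cK c : u <= c <= v -> c `^ (p - 1) <= K.
  move=> /andP[uc cv].
  have [p1|p1] := leP 0 (p - 1).
    apply: (@le_trans _ _ (v `^ (p - 1))); last by rewrite lerDr powR_ge0.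
    by rewrite ge0_ler_powR ?nnegrE// ltW// ?(lt_le_trans u0)// (le_trans uc).
  apply: (@le_trans _ _ (u `^ (p - 1))); last by rewrite lerDl powR_ge0.
  by rewrite le0_ger_powR// ltW.
have hle s t : u <= s <= v -> u <= t <= v -> s <= t ->
    `|t `^ p - s `^ p| <= `|p| * K * `|t - s|.
  move=> /andP[us sv] /andP[ut tv] st.
  have [c /andP[sc ct] ->] := powR_MVT p (lt_le_trans u0 us) st.
  rewrite !normrM [ `|_ `^ _| ]ger0_norm ?powR_ge0//.
  rewrite ler_wpM2r// ler_wpM2l//; apply: cK.
  by rewrite (le_trans us sc) (le_trans ct tv).
exists (`|p| * K) => s t su tu.
have [st|/ltW ts] := leP s t; last exact: hle.
by rewrite distrC [ `|s - t| ]distrC; exact: hle.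
Qed.

Lemma lipschitz_poly_approx (f : R -> R) (u v L : R) : u <= v ->
  (forall s t, u <= s <= v -> u <= t <= v -> `|f s - f t| <= L * `|s - t|) ->
  exists P : nat -> {poly R}, forall e, 0 < e -> \forall n \near \oo,
    forall t, u <= t <= v -> `|(P n).[t] - f t| <= e.
Proof.
rewrite le_eqVlt => /predU1P[<- _|uv fL].
  exists (fun=> (f u)%:P) => e e0; apply: nearW => n t.
  by rewrite -eq_le => /eqP <-; rewrite hornerC subrr normr0 ltW.
have w0 : 0 < v - u by rewrite subr_gt0.
pose g s := f (u + (v - u) * s).
have uvE s : 0 <= s <= 1 -> u <= u + (v - u) * s <= v.
  by move=> /andP[s0 s1]; apply/andP; split; nra.
have gL s t : 0 <= s <= 1 -> 0 <= t <= 1 ->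
    `|g s - g t| <= (L * (v - u)) * `|s - t|.
  move=> /uvE hs /uvE ht; apply: le_trans (fL _ _ hs ht) _.
  by rewrite opprD addrACA subrr add0r -mulrBr normrM (gtr0_norm w0) mulrA.
pose P n := (bernstein n (fun k => g (k%:R / n%:R))) \Po ((v - u)^-1 *: ('X - u%:P)).
exists P => e e0.
have L1 : 0 < `|L * (v - u)| + 1 by rewrite ltr_wpDl.
(* Adding [1] keeps the denominator positive. *)
pose d := e / (`|L * (v - u)| + 1).
have d0 : 0 < d by rewrite divr_gt0.
have d2 : 0 < d ^+ 2 by rewrite exprn_gt0.
near=> n => t /andP[ut tv]; rewrite horner_comp !hornerE.
have t01 : 0 <= (v - u)^-1 * (t - u) <= 1.
  rewrite mulr_ge0 ?invr_ge0 ?subr_ge0 ?(ltW uv)//= ler_pdivrMl// mulr1.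
  by rewrite lerD2r.
have -> : f t = g ((v - u)^-1 * (t - u)).
  by rewrite /g mulrA mulfV ?lt0r_neq0// mul1r addrC subrK.
apply: (@le_trans _ _ ((L * (v - u)) * d)); last first.
  apply: le_trans (ler_norm _) _; rewrite normrM (gtr0_norm d0) /d mulrCA.
  rewrite ler_piMr ?(ltW e0)//.
  by rewrite ler_pdivrMr// mul1r lerDl.
apply: bernstein_lipschitz => //.
rewrite -ler_pdivrMr// mul1r; near: n; exact: nbhs_infty_ger.
Unshelve. all: by end_near. Qed.

End UniformPolynomialApproximation.

(** * The functional calculus *)

Section FunctionalCalculus.
Variables (R : realType) (H : hilbertType R).
Implicit Types (x y z : H) (a : R) (X Y Z T S D : 'B(H)) (P Q : {poly R})
  (f g : R -> R).

Lemma opbound_opnorm T : opbound T (opnorm T).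
Proof.
have [C C0 TC] := opboundP T.
pose E := [set complex.Re `|T x| | x in [set x | `|x| <= 1]].
have Esup : has_sup E.
  split; first by exists (rnorm (T 0)), 0 => //; rewrite /= normr0 ler01.
  exists C => _ [x /= x1 <-]; apply: le_trans (TC x) _.
  by rewrite ger_pMr//; move: x1; rewrite rnormE -(rmorph1 (real_complex R)) lecR.
move=> x; have [->|x0] := eqVneq x 0.
  by rewrite op0 /rnorm normr0 mulr0.
have nx : 0 < rnorm x by rewrite lt_neqAle rnorm_ge0 andbT eq_sym rnorm_eq0.
rewrite -ler_pdivrMr// mulrC -[(rnorm x)^-1]ger0_norm ?invr_ge0 ?(ltW nx)//.
rewrite -rnormZ -opZ; apply: (ub_le_sup Esup.2).
exists ((rnorm x)^-1%:C *: x) => //=.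
by rewrite rnormE rnormZ ger0_norm ?invr_ge0 ?(ltW nx)// mulVf ?gt_eqF.
Qed.

Lemma opnorm_le T (c : R) : 0 <= c -> opbound T c -> opnorm T <= c.
Proof.
move=> c0 Tc; apply: ge_sup.
  by exists (rnorm (T 0)), 0 => //; rewrite /= normr0 ler01.
move=> _ [x /= x1 <-]; apply: le_trans (Tc x) _.
by rewrite ler_piMr//; move: x1; rewrite rnormE -(rmorph1 (real_complex R)) lecR.
Qed.

Lemma opnorm_ge0 T : 0 <= opnorm T.
Proof.
have [C C0 TC] := opboundP T.
apply: ub_le_sup.
  exists C => _ [x /= x1 <-]; apply: le_trans (TC x) _.
  by rewrite ger_pMr//; move: x1; rewrite rnormE -(rmorph1 (real_complex R)) lecR.
by exists 0; rewrite /= ?normr0 ?ler01// op0 normr0.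
Qed.

Lemma op_cvgP (T : nat -> 'B(H)) L :
  op_cvg T L <-> opnorm (T n - L) @[n --> \oo] --> (0 : R).
Proof.
split=> [TL|/cvgrPdist_le TL e e0].
  apply/cvgrPdist_le => e e0; apply: filterS (TL e e0) => n hn.
  by rewrite sub0r normrN ger0_norm ?opnorm_ge0// opnorm_le// ltW.
apply: filterS (TL e e0) => n; rewrite sub0r normrN ger0_norm ?opnorm_ge0// => hn.
exact: opbound_le hn (opbound_opnorm _).
Qed.

Lemma uniform_cvgP (A : set R) (F : nat -> R -> R) f :
  {uniform A, F @ \oo --> f} <->
  forall e : R, 0 < e -> \forall n \near \oo, forall t, A t -> `|F n t - f t| <= e.
Proof.
split=> [Ff e e0|Ff U /uniform_nbhs[E [entE EU]]].
  have : nbhs (f : {uniform` A -> R}) [set h | forall t, A t -> ball (f t) e (h t)].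
    apply/uniform_nbhs; exists [set xy | ball xy.1 e xy.2]; split => //.
    exact: (entourage_ball (R : pseudoMetricType R) (PosNum e0)).
  move=> /Ff fF; have {}fF : \forall n \near \oo,
    forall t, A t -> ball (f t) e (F n t) := fF.
  apply: filterS fF => n hn t At.
  by have := hn t At; rewrite /ball /= distrC => /ltW.
have : exists2 e : R, 0 < e & forall s t : R, `|s - t| < e -> E (s, t).
  move: entE; rewrite -entourage_ballE => -[e /= e0 eE]; exists e => // u v uv.
  exact: (eE (u, v)).
move=> [e e0 eE]; have e2 : 0 < e / 2 by rewrite divr_gt0.
apply: filterS (Ff _ e2) => n hn; apply: EU => t At; apply: eE.
by rewrite distrC (le_lt_trans (hn t At))// ltr_pdivrMr// ltr_pMr// ltr1n.
Qed.

Lemma is_fcalcP f X Y : is_fcalc f X Y <-> exists P : nat -> {poly R},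
  (forall e : R, 0 < e -> \forall n \near \oo,
     forall t, spectrum X t%:C -> `|(P n).[t] - f t| <= e) /\
  op_cvg (fun n => op_horner (P n) X) Y.
Proof.
by split=> -[P [/uniform_cvgP h1 /op_cvgP h2]]; exists P; split.
Qed.

Lemma is_fcalc_horner P X : is_fcalc (horner P) X (op_horner P X).
Proof.
apply/is_fcalcP; exists (fun=> P); split; last exact: op_cvg_cst.
by move=> e e0; apply: nearW => n t _; rewrite subrr normr0 ltW.
Qed.

Lemma fcalc_selfadjoint f X Y : selfadjoint X -> is_fcalc f X Y -> selfadjoint Y.
Proof.
move=> sX /is_fcalcP[P [_ PY]]; apply: (selfadjoint_cvg PY) => n.
exact: selfadjoint_horner.
Qed.

(** For large [n], the approximants satisfy [P n <= Q n + d] on the spectrum, so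
    [P n (X) <= Q n (X) + d] by [op_horner_le]. *)
Lemma fcalc_le f g X Y Z : selfadjoint X -> is_fcalc f X Y -> is_fcalc g X Z ->
  (forall t, spectrum X t%:C -> f t <= g t) -> Y ⪯ Z.
Proof.
move=> sX /[dup] /(fcalc_selfadjoint sX) sY /is_fcalcP[P [Pf PY]]
  /[dup] /(fcalc_selfadjoint sX) sZ /is_fcalcP[Q [Qg QZ]] fg.
apply/op_leP; split=> // x; rewrite -subr_ge0 -rinnerBl -bopBE.
have PQ : op_cvg (fun n => op_horner (Q n - P n) X) (Z - Y).
  by under eq_fun do rewrite op_hornerB; exact: op_cvgB.
apply/ler_addgt0Pr => e e0.
have x1 : 0 < rnorm x ^+ 2 + 1 by rewrite ltr_wpDl ?sqr_ge0.
pose d := e / (rnorm x ^+ 2 + 1).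
have d2 : 0 < d / 2 by rewrite !divr_gt0.
have : - d * rnorm x ^+ 2 <= rinner ((Z - Y) x) x.
  apply: (rinner_cvg_le PQ); apply: filterS2 (Pf _ d2) (Qg _ d2) => n Pn Qn.
  rewrite -rinner_scalar -(op_hornerC _ X); apply: op_horner_le => // t st.
  have := Pn t st; have := Qn t st; have := fg t st.
  by rewrite !hornerE !ler_norml; lra.
rewrite mulNr lerNl => h; rewrite -lerBlDr sub0r lerNl; apply: le_trans h _.
by rewrite /d mulrAC ler_pdivrMr// ler_pM2l// lerDl.
Qed.

(** In particular the value of the calculus does not depend on the polynomials
    that approximate the function. *)
Lemma fcalc_unique f g X Y Z : selfadjoint X -> is_fcalc f X Y -> is_fcalc g X Z ->
  (forall t, spectrum X t%:C -> f t = g t) -> Y = Z.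
Proof.
move=> sX fY gZ fg.
by apply: op_le_anti; [apply: fcalc_le fY gZ _|apply: fcalc_le gZ fY _] => // t /fg ->.
Qed.

Lemma horner_bounded P (C : R) : exists K, forall t, `|t| <= C -> `|P.[t]| <= K.
Proof.
elim/poly_ind: P => [|P c [K PK]]; first by exists 0 => t _; rewrite horner0 normr0.
exists (K * C + `|c|) => t tC; rewrite !hornerE.
by rewrite (le_trans (ler_normD _ _))// lerD// normrM ler_pM// PK.
Qed.

Lemma spectrum_bounded X : selfadjoint X ->
  exists C : R, forall t, spectrum X t%:C -> `|t| <= C.
Proof.
move=> sX; have [C C0 XC] := opboundP X; exists C => t st.
have h x := normr_rinner_le (ltW C0) (XC x).
rewrite ler_norml; apply/andP; split.
  by apply: spectrum_ge st => // x; have := h x; rewrite mulNr ler_norml => /andP[].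
by apply: spectrum_le st => // x; have := h x; rewrite ler_norml => /andP[].
Qed.

(** The function is within [1] of a polynomial on a bounded set. *)
Lemma fcalc_bounded f X Y : selfadjoint X -> is_fcalc f X Y ->
  exists K, forall t, spectrum X t%:C -> `|f t| <= K.
Proof.
move=> sX /is_fcalcP[P [Pf _]]; have [C XC] := spectrum_bounded sX.
have [n hn] := filter_ex (Pf 1 ltr01).
have [K PK] := horner_bounded (P n) C; exists (K + 1) => t st.
rewrite -[f t](subrK (P n).[t]) addrC (le_trans (ler_normD _ _))// lerD//.
  exact/PK/XC.
by rewrite distrC hn.
Qed.

(** The products [P n * Q n] approximate [f g] uniformly because [f] and [g] are
    bounded on the spectrum. *)
Lemma fcalcM f g X Y Z : selfadjoint X -> is_fcalc f X Y -> is_fcalc g X Z ->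
  is_fcalc (fun t => f t * g t) X (Y * Z).
Proof.
move=> sX fY gZ.
have [F fF] := fcalc_bounded sX fY; have [G gG] := fcalc_bounded sX gZ.
move: fY gZ => /is_fcalcP[P [Pf PY]] /is_fcalcP[Q [Qg QZ]].
apply/is_fcalcP; exists (fun n => P n * Q n); split; last first.
  by under eq_fun do rewrite op_hornerM; exact: op_cvgM.
move=> e e0.
have F1 : 0 < `|F| + 1 by rewrite ltr_wpDl.
have G1 : 0 < `|G| + 1 by rewrite ltr_wpDl.
have eF : 0 < e / 2 / (`|F| + 1) by rewrite !divr_gt0.
have eG : 0 < e / 2 / (`|G| + 1) by rewrite !divr_gt0.
apply: filterS3 (Pf _ eG) (Qg _ eF) (Qg _ ltr01) => n h1 h2 h3 t st.
have -> : (P n * Q n).[t] - f t * g t =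
    ((P n).[t] - f t) * (Q n).[t] + f t * ((Q n).[t] - g t).
  by rewrite hornerM; ring.
have -> : e = e / 2 / (`|G| + 1) * (`|G| + 1) + (`|F| + 1) * (e / 2 / (`|F| + 1)).
  by field; rewrite !lt0r_neq0.
rewrite (le_trans (ler_normD _ _))// lerD// normrM ler_pM//; [exact: h1| | |exact: h2].
  rewrite -[(Q n).[t]](subrK (g t)) addrC (le_trans (ler_normD _ _))// lerD ?h3//.
  exact: le_trans (gG t st) (ler_norm _).
by rewrite (le_trans (fF t st))// (le_trans (ler_norm _))// lerDl.
Qed.

(** Uniform approximation on the spectrum makes [P n (X)] a Cauchy sequence, by
    [opbound_horner]. *)
Lemma fcalc_exists f X (P : nat -> {poly R}) : selfadjoint X ->
  (forall e : R, 0 < e -> \forall n \near \oo,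
     forall t, spectrum X t%:C -> `|(P n).[t] - f t| <= e) ->
  is_fcalc f X (fcalc f X).
Proof.
move=> sX Pf; have [Y PY] : exists Y, op_cvg (fun n => op_horner (P n) X) Y.
  apply: op_complete => e e0; have e2 : 0 < e / 2 by rewrite divr_gt0.
  have [N _ hN] := Pf _ e2; exists N => n m Nn Nm.
  rewrite -op_hornerB; apply: opbound_horner => // [|t st]; first exact: ltW.
  rewrite !hornerE [e]splitr -[_ - _](subrKA (f t)) (le_trans (ler_normD _ _))// lerD//.
    exact: hN.
  by rewrite distrC; exact: hN.
by apply: (xgetPex 0); exists Y; apply/is_fcalcP; exists P.
Qed.

Lemma op_powR_fcalc X (c p : R) : selfadjoint X -> 0 < c ->
  (forall x, c * rnorm x ^+ 2 <= rinner (X x) x) ->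
  is_fcalc (fun t => t `^ p) X (op_powR X p).
Proof.
move=> sX c0 Xc; have [C XC] := spectrum_bounded sX.
have cC : c <= c + `|C| by rewrite lerDl.
have [L pL] := @powR_lipschitz R p c (c + `|C|) c0.
have [P hP] := lipschitz_poly_approx cC pL.
apply: (fcalc_exists (P := P)) => // e e0.
apply: filterS (hP e e0) => n hn t st; apply: hn.
rewrite (spectrum_ge sX Xc st)/= (le_trans (ler_norm t))//.
by rewrite (le_trans (XC t st))// (le_trans (ler_norm C))// lerDr ltW.
Qed.

(** These identities hold for the functions [t ^ (1/2)] and [t ^ (-1/2)] on the
    spectrum, which is bounded below by a positive constant. *)
Lemma op_sqrt_invsqrt (A : 'B(H)) : op_gt0 A ->
  let h := op_powR A 2^-1 in let k := op_powR A (- 2^-1) in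
  [/\ selfadjoint h, selfadjoint k, h * h = A, h * k = 1 & k * h = 1].
Proof.
move=> [A0 iA] h k; have [c c0 Ac] := invertible_coercive A0 iA.
have /positiveP[sA _] := A0.
have hP := op_powR_fcalc 2^-1 sA c0 Ac; have kP := op_powR_fcalc (- 2^-1) sA c0 Ac.
have t0 t : spectrum A t%:C -> 0 < t.
  by move=> st; apply: lt_le_trans c0 (spectrum_ge sA Ac st).
have one : op_horner 1 A = 1 by rewrite op_hornerC scale1r.
split.
- exact: fcalc_selfadjoint hP.
- exact: fcalc_selfadjoint kP.
- rewrite -[RHS]op_hornerX.
  apply: (fcalc_unique sA (fcalcM sA hP hP) (is_fcalc_horner _ _)) => t /t0 t0'.
  rewrite -powRD ?(gt_eqF t0') ?implybT// (_ : 2^-1 + 2^-1 = 1); last by field.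
  by rewrite powRr1 ?ltW// hornerX.
- rewrite -one; apply: (fcalc_unique sA (fcalcM sA hP kP) (is_fcalc_horner _ _)).
  by move=> t /t0 t0'; rewrite powRN mulfV ?gt_eqF ?powR_gt0// hornerC.
- rewrite -one; apply: (fcalc_unique sA (fcalcM sA kP hP) (is_fcalc_horner _ _)).
  by move=> t /t0 t0'; rewrite powRN mulVf ?gt_eqF ?powR_gt0// hornerC.
Qed.

End FunctionalCalculus.

(** * Tangent bounds for operator means *)

Section MeansAndMaps.
Variables (R : realType) (H : hilbertType R).
Implicit Types (x : H) (a s p t : R) (A B X Y S T : 'B(H)).

Lemma powR_slope p t : 1 <= t ->
  exists2 c, 1 <= c <= t & t `^ p = 1 + p * c `^ (p - 1) * (t - 1).
Proof.
move=> t1; have [c ct h] := powR_MVT p ltr01 t1; exists c => //.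
by rewrite -h powR1 addrC subrK.
Qed.

Lemma op_gt0_selfadjoint A : op_gt0 A -> selfadjoint A.
Proof. by move=> [/positiveP[]]. Qed.

Section MeanTangent.
Variables (A B : 'B(H)) (s p : R).
Let X := op_powR A (- 2^-1) * B * op_powR A (- 2^-1).
Hypotheses (A0 : op_gt0 A) (X1 : 1 ⪯ X).

Let meanE : A ♮_p B = op_powR A 2^-1 * op_powR X p * op_powR A 2^-1.
Proof. by []. Qed.

Let tangent : {poly R} := 1 + s *: ('X - 1).

Let tangentE t : tangent.[t] = 1 + s * (t - 1).
Proof. by rewrite !hornerE. Qed.

Let sX : selfadjoint X. Proof. by case: X1. Qed.

Let X_ge1 x : 1 * rnorm x ^+ 2 <= rinner (X x) x.
Proof. by rewrite mul1r -rinnerxx; have /op_leP[_ _] := X1; apply. Qed.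

Let conj_tangent : op_powR A 2^-1 * op_horner tangent X * op_powR A 2^-1 =
  A + s%:C *: (B - A).
Proof.
have [_ _ hh hk kh] := op_sqrt_invsqrt A0.
set h := op_powR A 2^-1 in hh hk kh *.
have hXh : h * X * h = B by rewrite /X !mulrA hk mul1r -mulrA kh mulr1.
rewrite op_hornerD op_hornerZ op_hornerB op_hornerX !op_hornerC scale1r.
rewrite mulrDr mulrDl mulr1 hh -bop_scalerAr -bop_scalerAl mulrBr mulrBl mulr1.
by rewrite hh hXh.
Qed.

(** The slope condition bounds [t ^ p] by the line [1 + s (t - 1)] on the spectrum
    of [X]; conjugation by [A ^ (1/2)] sends [1] to [A] and [X] to [B]. *)
Lemma op_mean_le :
  (forall t, spectrum X t%:C -> forall c, 1 <= c <= t -> p * c `^ (p - 1) <= s) ->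
  A ♮_p B ⪯ A + s%:C *: (B - A).
Proof.
move=> slope; have [sh _ _ _ _] := op_sqrt_invsqrt A0.
rewrite -conj_tangent meanE; apply: (op_le_conj sh).
apply: (fcalc_le sX (op_powR_fcalc p sX ltr01 X_ge1) (is_fcalc_horner tangent X)).
move=> t st; have t1 := spectrum_ge sX X_ge1 st.
have [c ct ->] := powR_slope p t1.
by rewrite tangentE lerD2l ler_wpM2r ?subr_ge0// (slope t).
Qed.

Lemma op_mean_ge :
  (forall t, spectrum X t%:C -> forall c, 1 <= c <= t -> s <= p * c `^ (p - 1)) ->
  A + s%:C *: (B - A) ⪯ A ♮_p B.
Proof.
move=> slope; have [sh _ _ _ _] := op_sqrt_invsqrt A0.
rewrite -conj_tangent meanE; apply: (op_le_conj sh).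
apply: (fcalc_le sX (is_fcalc_horner tangent X) (op_powR_fcalc p sX ltr01 X_ge1)).
move=> t st; have t1 := spectrum_ge sX X_ge1 st.
have [c ct ->] := powR_slope p t1.
by rewrite tangentE lerD2l ler_wpM2r ?subr_ge0// (slope t).
Qed.

End MeanTangent.

Lemma op_le_denormalize A B : op_gt0 A ->
  1 ⪯ op_powR A (- 2^-1) * B * op_powR A (- 2^-1) -> A ⪯ B.
Proof.
move=> A0; have [sh sk hh hk kh] := op_sqrt_invsqrt A0 => /(op_le_conj sh).
by rewrite mulr1 hh !mulrA hk mul1r -mulrA kh mulr1.
Qed.

Lemma op_le_normalize A B : op_gt0 A -> A ⪯ B ->
  1 ⪯ op_powR A (- 2^-1) * B * op_powR A (- 2^-1).
Proof.
move=> A0; have [sh sk hh hk kh] := op_sqrt_invsqrt A0 => /(op_le_conj sk).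
by rewrite -{2}hh !mulrA kh mul1r hk.
Qed.

(** * Positive unital maps *)

Section PositiveMap.
Variable Phi : {linear 'B(H) -> 'B(H)}.
Hypotheses (Phi_pos : positive_map Phi) (Phi1 : Phi 1 = 1).

(** A self-adjoint operator is the difference of a positive operator and a
    scalar. *)
Lemma positive_map_selfadjoint S : selfadjoint S -> selfadjoint (Phi S).
Proof.
move=> sS; have [C C0 SC] := opboundP S.
rewrite -[S](addrK (C%:C *: (1 : 'B(H)))) linearB linearZ /= Phi1.
apply/selfadjointB/selfadjoint_scalar.
have /Phi_pos/positiveP[] // : positive (S + C%:C *: (1 : 'B(H))).
apply/positiveP; split; first exact/selfadjointD/selfadjoint_scalar.
move=> x; rewrite bopDE rinnerDl rinner_scalar.
by have := normr_rinner_le (ltW C0) (SC x); rewrite ler_norml; lra.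
Qed.

Lemma positive_map_le S T : S ⪯ T -> Phi S ⪯ Phi T.
Proof.
move=> [sS sT ST]; split; [exact: positive_map_selfadjoint..|].
by rewrite -linearB; exact: Phi_pos.
Qed.

(** Invertibility is preserved because [c <= A] gives [c <= Phi A]. *)
Lemma positive_map_gt0 A : op_gt0 A -> op_gt0 (Phi A).
Proof.
move=> [A0 iA]; split; first exact: Phi_pos.
have [c c0 Ac] := invertible_coercive A0 iA.
have /positiveP[sA _] := A0.
have : c%:C *: (1 : 'B(H)) ⪯ A.
  by apply/op_leP; split=> // [|x]; [exact: selfadjoint_scalar|rewrite rinner_scalar].
move=> /positive_map_le/op_leP; rewrite linearZ /= Phi1 => -[_ sPA h].
by apply: (coercive_invertible c0 sPA) => x; rewrite -rinner_scalar h.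
Qed.

End PositiveMap.

End MeansAndMaps.

(** * The reverse inequalities *)

Theorem corollary2p1 (R : realType) (H : hilbertType R) (A B : 'B(H)) (m M : R)
    (Phi : {linear 'B(H) -> 'B(H)}) :
  op_gt0 A -> op_gt0 B ->
  op_gt0 (m%:C *: (1 : 'B(H))) ->
  m%:C *: (1 : 'B(H)) ⪯ 1 ->
  1 ⪯ op_powR A (- 2^-1) * B * op_powR A (- 2^-1) ->
  op_powR A (- 2^-1) * B * op_powR A (- 2^-1) ⪯ M%:C *: (1 : 'B(H)) ->
  positive_map Phi -> Phi 1 = 1 ->
  [/\ forall p : R, 0 <= p <= 1 ->
        Phi A ♮_p Phi B
        ⪯ Phi (A ♮_p B)
            + (p * (m `^ (p - 1) - M `^ (p - 1)))%:C *: Phi (B - A),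
      forall p : R, -1 <= p <= 0 ->
        Phi (A ♮_p B) + (p * (m `^ (p - 1) - M `^ (p - 1)))%:C *: Phi (B - A)
        ⪯ Phi A ♮_p Phi B
    & forall p : R, 1 <= p <= 2 ->
        Phi (A ♮_p B)
        ⪯ Phi A ♮_p Phi B
            + (p * (M `^ (p - 1) - m `^ (p - 1)))%:C *: Phi (B - A)].
Proof.
move=> A0 B0 m0 m1 X1 XM Phi_pos Phi1.
(* On the zero space all operators are equal, and [m] and [M] are arbitrary. *)
have [[x x0]|triv] := pselect (exists x : H, x != 0); last first.
  have all_le (S T : 'B(H)) : S ⪯ T.
    have all0 (U : 'B(H)) : U = 0.
      apply: bopP => y; apply: contrapT => Uy; apply: triv.
      by exists (U y); apply/eqP.
    by rewrite (all0 S) (all0 T); apply/op_leP; split => //; exact: selfadjoint0.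
  by split=> p _; exact: all_le.
have x2 : 0 < rnorm x ^+ 2 by rewrite exprn_even_gt0// rnorm_eq0.
have {m1} m1 : m <= 1.
  have /op_leP[_ _ /(_ x)] := m1.
  by rewrite rinner_scalar bop1E rinnerxx -{2}[_ ^+ 2]mul1r ler_pM2r.
have {m0} m0 : 0 < m.
  have [m_pos im] := m0; have [c c0 /(_ x)] := invertible_coercive m_pos im.
  by rewrite rinner_scalar ler_pM2r//; exact: lt_le_trans.
have sA := op_gt0_selfadjoint A0; have sB := op_gt0_selfadjoint B0.
have PA0 := positive_map_gt0 Phi_pos Phi1 A0.
have sPB := positive_map_selfadjoint Phi_pos Phi1 sB.
have PX1 : 1 ⪯ op_powR (Phi A) (- 2^-1) * Phi B * op_powR (Phi A) (- 2^-1).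
  apply: (op_le_normalize PA0); apply: (positive_map_le Phi_pos Phi1).
  exact: op_le_denormalize X1.
have tM t : spectrum (op_powR A (- 2^-1) * B * op_powR A (- 2^-1)) t%:C -> t <= M.
  have /op_leP[sX _ XM'] := XM; apply: spectrum_le => // y.
  by rewrite -rinner_scalar.
set D := Phi B - Phi A.
have sD : selfadjoint D by apply: selfadjointB sPB _; apply: op_gt0_selfadjoint.
have PhiE (s : R) : Phi (A + s%:C *: (B - A)) = Phi A + s%:C *: D.
  by rewrite linearD linearZ linearB.
(* The term [Phi A] is common to the two tangent bounds, which therefore differ
   by [(v - u) D]. *)
have shift (u v : R) S T : S ⪯ Phi A + v%:C *: D ->  Phi A + u%:C *: D ⪯ T ->
    S ⪯ T + (v - u)%:C *: D.
  have -> : Phi A + v%:C *: D = Phi A + u%:C *: D + (v - u)%:C *: D.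
    by rewrite -addrA -scalerDl -rmorphD [u + _]addrC subrK.
  move=> Sv uT; apply: op_le_trans Sv _; apply: op_leD uT _.
  by apply/op_leP; split=> //; exact: selfadjointZ.
have shift' (u v : R) S T : S ⪯ Phi A + v%:C *: D ->  Phi A + u%:C *: D ⪯ T ->
    S + (u - v)%:C *: D ⪯ T.
  have -> : Phi A + u%:C *: D = Phi A + v%:C *: D + (u - v)%:C *: D.
    by rewrite -addrA -scalerDl -rmorphD [v + _]addrC subrK.
  move=> Sv uT; apply: op_le_trans uT; apply: op_leD Sv _.
  by apply/op_leP; split=> //; exact: selfadjointZ.
have PhiBA : Phi (B - A) = D by rewrite linearB.
have Phi_le := positive_map_le Phi_pos Phi1.
have neg_slope (p c : R) : p <= 1 -> 1 <= c ->
    c `^ (p - 1) <= m `^ (p - 1) /\ (c <= M -> M `^ (p - 1) <= c `^ (p - 1)).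
  move=> p1 c1; have p10 : p - 1 <= 0 by rewrite subr_le0.
  split=> [|cM]; apply: le0_ger_powR => //; first exact: le_trans c1.
  exact: lt_le_trans c1.
have pos_slope (p c : R) : 1 <= p -> 1 <= c ->
    m `^ (p - 1) <= c `^ (p - 1) /\ (c <= M -> c `^ (p - 1) <= M `^ (p - 1)).
  move=> p1 c1; have p10 : 0 <= p - 1 by rewrite subr_ge0.
  have c0 : 0 <= c by exact: le_trans c1.
  split=> [|cM]; apply: ge0_ler_powR => //; rewrite ?nnegrE ?(ltW m0)//.
    exact: le_trans c1.
  exact: le_trans cM.
split=> p /andP[p0 p1]; rewrite PhiBA mulrBr.
- apply: shift.
    apply: (op_mean_le PA0 PX1) => t _ c /andP[c1 _].
    by rewrite ler_wpM2l//; exact: (neg_slope p c p1 c1).1.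
  rewrite -PhiE; apply: Phi_le; apply: (op_mean_ge A0 X1) => t /tM tM' c /andP[c1 ct].
  by rewrite ler_wpM2l//; apply: (neg_slope p c p1 c1).2; exact: le_trans tM'.
- have p1' : p <= 1 by apply: le_trans p1 _.
  apply: shift'.
    rewrite -PhiE; apply: Phi_le; apply: (op_mean_le A0 X1) => t /tM tM' c /andP[c1 ct].
    by rewrite ler_wnM2l//; apply: (neg_slope p c p1' c1).2; exact: le_trans tM'.
  apply: (op_mean_ge PA0 PX1) => t _ c /andP[c1 _].
  by rewrite ler_wnM2l//; exact: (neg_slope p c p1' c1).1.
- have p0' : 0 <= p by apply: le_trans p0.
  apply: shift.
    rewrite -PhiE; apply: Phi_le; apply: (op_mean_le A0 X1) => t /tM tM' c /andP[c1 ct].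
    by rewrite ler_wpM2l//; apply: (pos_slope p c p0 c1).2; exact: le_trans tM'.
  apply: (op_mean_ge PA0 PX1) => t _ c /andP[c1 _].
  by rewrite ler_wpM2l//; exact: (pos_slope p c p0 c1).1.
Qed.
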